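(* Let $A,B$ be unit-free MALL formulas and $\theta,\theta'$ cut-free proof-nets with conclusions $A^\perp,B$ and $B^\perp,A$ respectively, such that the composition of $\theta$ and $\theta'$ over $B$ reduces by cut-elimination to the identity proof-net of $A$ and the composition of $\theta'$ and $\theta$ over $A$ reduces to the identity proof-net of $B$. Then $\theta$ and $\theta'$ are bipartite and full.
   Context: Unit-free MALL formulas $A::=X\mid X^\perp\mid A\otimes A\mid A⅋A\mid A\&A\mid A\oplus A$, $(A\otimes B)^\perp=B^\perp⅋A^\perp$, $(A\&B)^\perp=B^\perp\oplus A^\perp$. Proof-nets (Hughes–van Glabbeek): a cut sequent $[\Sigma]\Gamma$ is a list $\Sigma$ of cut pairs $A*A^\perp$ and a sequent $\Gamma$, seen as a forest of syntactic trees with atom occurrences as leaves. Additive resolution: delete zero or more cut pairs and one argument subtree of each $\&$/$\oplus$; $\&$-resolution: delete one argument of each $\&$. Link: pair of leaves labelled $X$, $X^\perp$. Linking: set of disjoint links whose leaves are exactly the leaves of an additive resolution. $\Lambda$ toggles $\&$-vertex $W$ if both premises of $W$ occur in the union of the resolutions of $\Lambda$; link $a$ depends on $W$ in $\Lambda$ if $a\in\lambda\setminus\lambda'$ for some $\lambda,\lambda'\in\Lambda$ with $W$ the only $\&$ toggled by $\{\lambda,\lambda'\}$. $\mathcal{G}_\Lambda$: union of the resolutions, the links, and jump edges $l\to W$ for leaves $l$ of links depending on $W$. Switching cycle: cycle using at most one in-edge (premise edge or jump) of each $⅋$/$\&$ vertex; $⅋$-switching of $\lambda$: delete one premise edge of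 each $⅋$. A proof-net is a set $\theta$ of linkings with (P0) each cut pair has a leaf in some linking, (P1) exactly one linking on each $\&$-resolution, (P2) each $⅋$-switching of each linking is a tree, (P3) each $\Lambda\subseteq\theta$ of size $\ge2$ toggles a $\&$ in no switching cycle of $\mathcal{G}_\Lambda$. Cut-free: $\Sigma=\emptyset$; conclusions $\Gamma$. Composition over $A$ of $\theta$ (conclusions $\Gamma,A$) and $\psi$ (conclusions $\Delta,A^\perp$): all unions $\lambda\cup\mu$, on $[A*A^\perp]\Gamma,\Delta$. Cut-elimination steps: atomic cut: merge links $(l,A),(A^\perp,m)$ into $(l,m)$; $\otimes/⅋$ cut: split into the two subformula cuts; $\&/\oplus$ cut: split, delete linkings choosing non-dual premises, garbage-collect unused cut pairs. Identity proof-net of $A$: translation of the fully axiom-expanded axiom proof of $\vdash A^\perp,A$ (atomic axiom $\mapsto\{\{(X,X^\perp)\}\}$; $⅋,\oplus_i$ keep the set; $\otimes$ takes pairwise unions; $\&$ takes union of sets). A cut-free proof-net with two conclusions $A^\perp,B$ is bipartite if every link joins a leaf of $A^\perp$ and a leaf of $B$; it is full if every leaf belongs to at least one link of some linking. *)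

(* Defs.v *)
From mathcomp Require Import all_boot.
From mathcomp Require Import boolp classical_sets.
From Stdlib Require Import Relations.

Set Implicit Arguments.
Unset Strict Implicit.
Unset Printing Implicit Defensive.

Local Open Scope classical_set_scope.

(** * Formulas and cut sequents *)

Inductive formula : Type :=
  | Var of nat
  | Neg of nat
  | Tens of formula & formula
  | Par of formula & formula
  | With of formula & formula
  | Plus of formula & formula.

(* Non-commutative De Morgan duality: the left argument of A faces the right
   argument of [dual A]. *)
Fixpoint dual (A : formula) : formula :=
  match A with
  | Var X => Neg X
  | Neg X => Var X
  | Tens A B => Par (dual B) (dual A)
  | Par A B => Tens (dual B) (dual A)
  | With A B => Plus (dual B) (dual A)
  | Plus A B => With (dual B) (dual A)
  end.

(* The formula A listed in [cuts] stands for the cut pair A * A^⊥. *)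
Record cutseq : Type := CutSeq { cuts : seq formula; concl : seq formula }.

(** * Vertices of the syntactic forest

   A vertex is the root of the tree containing it together with its address
   in this tree ([false] = left, [true] = right). The root [inl i] is the i-th
   cut pair, a tree whose top vertex [(inl i, [::])] is the * and whose
   arguments are A (left) and A^⊥ (right); the root [inr j] is the j-th
   conclusion. Not every value of this type is a vertex of a given cut
   sequent: see [label]. *)

Definition vertex : Type := ((nat + nat) * seq bool)%type.

Inductive kind : Type :=
  | KVar of nat | KNeg of nat | KTens | KPar | KWith | KPlus | KCut.

Definition kind_of (A : formula) : kind :=
  match A with
  | Var X => KVar X
  | Neg X => KNeg X
  | Tens _ _ => KTens
  | Par _ _ => KPar
  | With _ _ => KWith
  | Plus _ _ => KPlus
  end.

Fixpoint subtree (A : formula) (p : seq bool) : option formula :=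
  match p, A with
  | [::], _ => Some A
  | b :: q, Tens A1 A2 | b :: q, Par A1 A2
  | b :: q, With A1 A2 | b :: q, Plus A1 A2 => subtree (if b then A2 else A1) q
  | _ :: _, _ => None
  end.

(* [None] when v is not a vertex of S. *)
Definition label (S : cutseq) (v : vertex) : option kind :=
  match v with
  | (inl i, p) =>
      if onth (cuts S) i is Some A then
        if p is b :: q
        then omap kind_of (subtree (if b then dual A else A) q)
        else Some KCut
      else None
  | (inr j, p) =>
      if onth (concl S) j is Some A then omap kind_of (subtree A p) else None
  end.

Definition leaf (S : cutseq) (v : vertex) : Prop :=
  exists X, label S v = Some (KVar X) \/ label S v = Some (KNeg X).
Definition isPar (S : cutseq) (v : vertex) : Prop := label S v = Some KPar.
Definition isWith (S : cutseq) (v : vertex) : Prop := label S v = Some KWith.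
Definition isPlus (S : cutseq) (v : vertex) : Prop := label S v = Some KPlus.
Definition additive (S : cutseq) (v : vertex) : Prop :=
  isWith S v \/ isPlus S v.

Definition premise (v : vertex) (b : bool) : vertex := (v.1, rcons v.2 b).

(* v belongs to the subtree with top vertex u *)
Definition above (u v : vertex) : Prop := u.1 = v.1 /\ prefix u.2 v.2.

(** * Resolutions *)

(* What remains of S after deleting the cut pairs in D and, for each vertex w
   satisfying P, the argument [del w] of w. *)
Definition remaining (S : cutseq) (P : vertex -> Prop) (D : set nat)
    (del : vertex -> bool) : set vertex :=
  [set v | [/\ label S v <> None,
               forall i, v.1 = inl i -> ~ D i
             & forall w, P w -> ~ above (premise w (del w)) v]].

Definition additive_resolution (S : cutseq) (R : set vertex) : Prop :=
  exists D del, R = remaining S (additive S) D del.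

Definition with_resolution (S : cutseq) (R : set vertex) : Prop :=
  exists del, R = remaining S (isWith S) set0 del.

Definition leaves (S : cutseq) (R : set vertex) : set vertex :=
  R `&` [set v | leaf S v].

(** * Links and linkings *)

Definition link : Type := set vertex.
Definition linking : Type := set link.

Definition is_link (S : cutseq) (a : link) : Prop :=
  exists l m X, [/\ label S l = Some (KVar X), label S m = Some (KNeg X)
                  & a = [set l; m]].

Definition support (lam : linking) : set vertex := \bigcup_(a in lam) a.

Definition is_linking (S : cutseq) (lam : linking) : Prop :=
  [/\ forall a, lam a -> is_link S a,
      trivIset lam id
    & exists2 R, additive_resolution S R & leaves S R = support lam].

(* The additive resolution of a linking; it is unique, as there are no units
   and hence an additive resolution is determined by its leaves. *)
Definition resolution (S : cutseq) (lam : linking) : set vertex :=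
  [set v | exists R, [/\ additive_resolution S R, leaves S R = support lam
                       & R v]].

Definition union_res (S : cutseq) (Lam : set linking) : set vertex :=
  \bigcup_(lam in Lam) resolution S lam.

Definition toggles (S : cutseq) (Lam : set linking) (W : vertex) : Prop :=
  isWith S W /\ forall b, union_res S Lam (premise W b).

Definition depends (S : cutseq) (Lam : set linking) (a : link) (W : vertex) :
    Prop :=
  exists lam lam', [/\ Lam lam, Lam lam', lam a, ~ lam' a
    & forall W', toggles S [set lam; lam'] W' <-> W' = W].

(** * Graphs

   Undirected graphs are given by a set of vertices V and an adjacency
   relation E. *)

Definition is_cycle (V : set vertex) (E : vertex -> vertex -> Prop)
    (c : seq vertex) : Prop :=
  [/\ uniq c, (2 < size c)%N, forall v, v \in c -> V v
    & forall v, v \in c -> E v (next c v)].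

Definition is_tree (V : set vertex) (E : vertex -> vertex -> Prop) : Prop :=
  [/\ V !=set0,
      forall u v, V u -> V v ->
        clos_refl_trans vertex (fun x y => [/\ V x, V y & E x y]) u v
    & forall c, ~ is_cycle V E c].

Definition jump (S : cutseq) (Lam : set linking) (l W : vertex) : Prop :=
  exists lam a, [/\ Lam lam, lam a, a l & depends S Lam a W].

(* u -> w is an in-edge of w in the graph G_Lam: a premise edge or a jump. *)
Definition in_edge (S : cutseq) (Lam : set linking) (u w : vertex) : Prop :=
  (exists b, u = premise w b) \/ jump S Lam u w.

Definition G_edge (S : cutseq) (Lam : set linking) (u v : vertex) : Prop :=
  [\/ in_edge S Lam u v, in_edge S Lam v u
    | exists2 lam, Lam lam & lam [set u; v]].

(* The only parallel edges of G_Lam are a premise edge and a jump with the same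
   end points l, W. Both are in-edges of W, so that cycles may be described by
   their vertices, without loss of switching cycles. *)
Definition switching_cycle (S : cutseq) (Lam : set linking) (c : seq vertex) :
    Prop :=
  is_cycle (union_res S Lam) (G_edge S Lam) c /\
  forall N, N \in c -> isPar S N \/ isWith S N ->
    ~ (in_edge S Lam (prev c N) N /\ in_edge S Lam (next c N) N).

(* Edges of the ⅋-switching of lam that deletes the premise edge [phi w] of
   each ⅋-vertex w. *)
Definition switch_prem (S : cutseq) (phi : vertex -> bool) (u w : vertex) :
    Prop :=
  exists2 b, u = premise w b & (isPar S w -> b <> phi w).

Definition switch_edge (S : cutseq) (lam : linking) (phi : vertex -> bool)
    (u v : vertex) : Prop :=
  [\/ switch_prem S phi u v, switch_prem S phi v u | lam [set u; v]].

(** * Proof-nets *)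

Definition P0 (S : cutseq) (theta : set linking) : Prop :=
  forall i, (i < size (cuts S))%N ->
    exists lam v, [/\ theta lam, support lam v & v.1 = inl i].

Definition P1 (S : cutseq) (theta : set linking) : Prop :=
  forall R, with_resolution S R ->
    exists! lam, theta lam /\ support lam `<=` R.

Definition P2 (S : cutseq) (theta : set linking) : Prop :=
  forall lam phi, theta lam ->
    is_tree (resolution S lam) (switch_edge S lam phi).

Definition P3 (S : cutseq) (theta : set linking) : Prop :=
  forall Lam, Lam `<=` theta ->
    (exists lam lam', [/\ Lam lam, Lam lam' & lam <> lam']) ->
    exists2 W, toggles S Lam W
      & forall c, switching_cycle S Lam c -> W \notin c.

Definition proof_net (S : cutseq) (theta : set linking) : Prop :=
  (forall lam, theta lam -> is_linking S lam) /\
  [/\ P0 S theta, P1 S theta, P2 S theta & P3 S theta].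

Definition cut_free (Gamma : seq formula) : cutseq := CutSeq [::] Gamma.

(** * Composition *)

Definition net : Type := (cutseq * set linking)%type.

(* Transport of a linking along a renaming of its leaves *)
Definition relocate (f : vertex -> vertex) (lam : linking) : linking :=
  [set [set f v | v in a] | a in lam].

Definition comp_left (n : nat) (v : vertex) : vertex :=
  match v with
  | (inr j, p) => if (j < n)%N then (inr j, p) else (inl 0, false :: p)
  | _ => v
  end.

Definition comp_right (n : nat) (v : vertex) : vertex :=
  match v with
  | (inr 0, p) => (inl 0, true :: p)
  | (inr j.+1, p) => (inr (n + j), p)
  | _ => v
  end.

(* Composition over A of theta, cut-free with conclusions Gamma, A, and psi,
   cut-free with conclusions A^⊥, Delta. *)
Definition compose (A : formula) (Gamma Delta : seq formula)
    (theta psi : set linking) : net :=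
  (CutSeq [:: A] (Gamma ++ Delta),
   [set relocate (comp_left (size Gamma)) lam `|`
        relocate (comp_right (size Gamma)) mu
     | lam in theta & mu in psi]).

(** * Cut elimination *)

Definition atomic (A : formula) : Prop :=
  match A with Var _ | Neg _ => True | _ => False end.

Definition drop_cut (i : nat) (v : vertex) : vertex :=
  match v with
  | (inl k, p) => (inl (if (k < i)%N then k else k.-1), p)
  | _ => v
  end.

Definition merge_links (i : nat) (lam : linking) : linking :=
  let c := (inl i, [:: false]) : vertex in
  let c' := (inl i, [:: true]) : vertex in
  [set a | [/\ lam a, ~ a c & ~ a c']] `|`
  [set a | exists l m, [/\ lam [set l; c], lam [set c'; m],
                           l <> c', m <> c & a = [set l; m]]].

(* The cut pair i on A with arguments A1, A2 becomes the cut pairs i on A1 and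
   i.+1 on A2. As [dual] exchanges arguments, A1^⊥ is the right argument of
   A^⊥: argument b on side s goes to the first cut pair when s = b. *)
Definition split_cut (i : nat) (v : vertex) : vertex :=
  match v with
  | (inl k, p) =>
      if (k < i)%N then v
      else if k == i then
        if p is s :: b :: q then (inl (i + (s (+) b)), s :: q) else v
      else (inl k.+1, p)
  | _ => v
  end.

(* The premises kept by lam above the i-th cut, on A (argument b) and on A^⊥
   (argument b'), are dual. *)
Definition consistent (S : cutseq) (i : nat) (lam : linking) : Prop :=
  forall b b', resolution S lam (inl i, [:: false; b]) ->
    resolution S lam (inl i, [:: true; b']) -> b' = ~~ b.

Definition used (theta : set linking) (k : nat) : Prop :=
  exists lam v, [/\ theta lam, support lam v & v.1 = inl k].

Definition collect (N : net) : net :=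
  let m := mkseq (fun k => `[< used N.2 k >]) (size (cuts N.1)) in
  let f (v : vertex) : vertex :=
    if v is (inl k, p) then (inl (count id (take k m)), p) else v in
  (CutSeq (mask m (cuts N.1)) (concl N.1), [set relocate f lam | lam in N.2]).

Inductive step : net -> net -> Prop :=
  | step_atom Sig1 A Sig2 Gamma theta :
      atomic A ->
      step (CutSeq (Sig1 ++ A :: Sig2) Gamma, theta)
           (CutSeq (Sig1 ++ Sig2) Gamma,
            [set relocate (drop_cut (size Sig1)) (merge_links (size Sig1) lam)
              | lam in theta])
  | step_mult Sig1 A A1 A2 Sig2 Gamma theta :
      A = Tens A1 A2 \/ A = Par A1 A2 ->
      step (CutSeq (Sig1 ++ A :: Sig2) Gamma, theta)
           (CutSeq (Sig1 ++ A1 :: A2 :: Sig2) Gamma,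
            [set relocate (split_cut (size Sig1)) lam | lam in theta])
  | step_add Sig1 A A1 A2 Sig2 Gamma theta :
      A = With A1 A2 \/ A = Plus A1 A2 ->
      step (CutSeq (Sig1 ++ A :: Sig2) Gamma, theta)
           (collect
             (CutSeq (Sig1 ++ A1 :: A2 :: Sig2) Gamma,
              [set relocate (split_cut (size Sig1)) lam
                | lam in theta `&`
                  consistent (CutSeq (Sig1 ++ A :: Sig2) Gamma)
                             (size Sig1)])).

Definition reduces : net -> net -> Prop := clos_refl_trans net step.

(** * Cut-free proofs with atomic axioms, and identity proof-nets *)

(* In the exchange rule, s lists the old positions of the new sequent. *)
Inductive proof : seq formula -> Type :=
  | ax X : proof [:: Neg X; Var X]
  | ex Gamma s : perm_eq s (iota 0 (size Gamma)) -> proof Gamma ->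
      proof [seq nth (Var 0) Gamma k | k <- s]
  | tens_rule A B Gamma Delta : proof (A :: Gamma) -> proof (B :: Delta) ->
      proof (Tens A B :: Gamma ++ Delta)
  | par_rule A B Gamma : proof (A :: B :: Gamma) -> proof (Par A B :: Gamma)
  | with_rule A B Gamma : proof (A :: Gamma) -> proof (B :: Gamma) ->
      proof (With A B :: Gamma)
  | plus1_rule A B Gamma : proof (A :: Gamma) -> proof (Plus A B :: Gamma)
  | plus2_rule A B Gamma : proof (B :: Gamma) -> proof (Plus A B :: Gamma).

Definition on_concl (f : nat -> seq bool -> nat * seq bool) (v : vertex) :
    vertex :=
  if v is (inr j, p) then (inr (f j p).1, (f j p).2) else v.

(* The first conclusion becomes argument b of a connective, and the other ones
   are shifted by n. *)
Definition graft (b : bool) (n : nat) : vertex -> vertex :=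
  on_concl (fun j p => if j is 0 then (0, b :: p) else (n + j, p)).

Definition graft_par : vertex -> vertex :=
  on_concl (fun j p => match j with
    | 0 => (0, false :: p)
    | 1 => (0, true :: p)
    | j'.+2 => (j'.+1, p)
    end).

Definition exchange (s : seq nat) : vertex -> vertex :=
  on_concl (fun j p => (index j s, p)).

Fixpoint translation Gamma (pi : proof Gamma) : set linking :=
  match pi with
  | ax _ => [set [set [set (inr 0, [::]); (inr 1, [::])]]]
  | ex _ s _ pi1 => [set relocate (exchange s) lam | lam in translation pi1]
  | tens_rule _ _ Gamma1 _ pi1 pi2 =>
      [set relocate (graft false 0) lam `|`
           relocate (graft true (size Gamma1)) mu
        | lam in translation pi1 & mu in translation pi2]
  | par_rule _ _ _ pi1 => [set relocate graft_par lam | lam in translation pi1]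
  | with_rule _ _ _ pi1 pi2 =>
      [set relocate (graft false 0) lam | lam in translation pi1] `|`
      [set relocate (graft true 0) lam | lam in translation pi2]
  | plus1_rule _ _ _ pi1 =>
      [set relocate (graft false 0) lam | lam in translation pi1]
  | plus2_rule _ _ _ pi1 =>
      [set relocate (graft true 0) lam | lam in translation pi1]
  end.

Definition swap2 A B (pi : proof [:: A; B]) : proof [:: B; A] :=
  @ex [:: A; B] [:: 1; 0] isT pi.

Definition swap3 A B C (pi : proof [:: A; B; C]) : proof [:: C; B; A] :=
  @ex [:: A; B; C] [:: 2; 1; 0] isT pi.

(* The axiom-expanded proof of A^⊥, A *)
Fixpoint id_proof (A : formula) : proof [:: dual A; A] :=
  match A return proof [:: dual A; A] with
  | Var X => ax X
  | Neg X => swap2 (ax X)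
  | Tens A B =>
      par_rule (swap3 (@tens_rule A B [:: dual A] [:: dual B]
        (swap2 (id_proof A)) (swap2 (id_proof B))))
  | Par A B =>
      swap2 (par_rule (swap3 (@tens_rule (dual B) (dual A) [:: B] [:: A]
        (id_proof B) (id_proof A))))
  | With A B =>
      swap2 (with_rule
        (swap2 (plus2_rule (dual B) (id_proof A)))
        (swap2 (plus1_rule (dual A) (id_proof B))))
  | Plus A B =>
      with_rule
        (swap2 (plus2_rule A (swap2 (id_proof B))))
        (swap2 (plus1_rule B (swap2 (id_proof A))))
  end.

Definition id_net (A : formula) : net :=
  (cut_free [:: dual A; A], translation (id_proof A)).

(** * Bipartite and full proof-nets *)

Definition bipartite (A B : formula) (theta : set linking) : Prop :=
  forall lam a, theta lam -> lam a ->
    exists l m, [/\ leaf (cut_free [:: dual A; B]) l /\ l.1 = inr 0,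
                    leaf (cut_free [:: dual A; B]) m /\ m.1 = inr 1
                  & a = [set l; m]].

Definition full (S : cutseq) (theta : set linking) : Prop :=
  forall v, leaf S v ->
    exists lam a, [/\ theta lam, lam a & a v].

(* Main.v *)
Require Import Defs.
From mathcomp Require Import all_boot zify.
From mathcomp Require Import boolp classical_sets.
(* [support] would otherwise denote a MathComp abbreviation. *)
Import Defs.

(* Label the links of a linking by tokens in such a way that dual leaves of each
   cut pair are both present, with equal tokens, or both absent; reading the
   tokens at the conclusions gives the relational semantics of a proof-net. It
   is invariant under cut elimination, it turns composition into composition of
   relations and the identity proof-net into the identity relation. Hence θ and
   θ' denote mutually inverse relations, that is, a bijection between the points
   of A and those of B. Changing the token of a link inside one conclusion would
   give two points related to the same one, so θ is bipartite; as the relation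
   is total and surjective and each leaf occurs in some point, θ is full. *)

Set Implicit Arguments.
Unset Strict Implicit.
Unset Printing Implicit Defensive.

Local Open Scope classical_set_scope.

(** * Leaves of an additive resolution of a formula *)

(** The deletions that define a resolution are awkward to follow through cut elimination, which only
    moves leaves. Resolutions are therefore replaced by their sets of leaves, described by recursion
    on the formula in [additive_leaves] and for a whole cut sequent in [resolved]. The invariant
    kept along a reduction is [well_formed]: links are disjoint pairs, and their leaves form a
    resolution. It is local enough to be checked one step at a time. The linkings discarded at an
    additive cut cost nothing: when the two sides keep non-dual premises, some leaf has no mirror
    image, so no labelling is matched. Tokens are natural numbers unrelated to the variables.
    Without them a point would be a mere resolution, and a link inside one conclusion would be
    invisible; two tokens, 0 and 1, are enough to detect it. *)

Definition branch (b : bool) (Y : set (seq bool)) : set (seq bool) :=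
  [set p | Y (b :: p)].

(** As [Y] is an arbitrary set of addresses, [~ Y [::]] is required at each connective: the branches
    say nothing about the empty address. Dual connectives have the same clause, so negation only
    flips addresses. *)
Fixpoint additive_leaves (A : formula) (Y : set (seq bool)) : Prop :=
  match A with
  | Var _ | Neg _ => Y = [set [::]]
  | Tens A1 A2 | Par A1 A2 =>
      [/\ ~ Y [::], additive_leaves A1 (branch false Y)
        & additive_leaves A2 (branch true Y)]
  | With A1 A2 | Plus A1 A2 =>
      exists b, [/\ ~ Y [::], additive_leaves (if b then A2 else A1) (branch b Y)
                  & forall b' p, Y (b' :: p) -> b' = b]
  end.

Definition is_additive (A : formula) : Prop :=
  match A with With _ _ | Plus _ _ => True | _ => False end.

Lemma additive_leaves_nonempty A Y : additive_leaves A Y -> exists p, Y p.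
Proof.
elim: A Y => [X|X|A1 IH1 A2 IH2|A1 IH1 A2 IH2|A1 IH1 A2 IH2|A1 IH1 A2 IH2] Y /=.
1-2: by move=> ->; exists [::].
1-2: by case=> _ /IH1 [p Yp] _; exists (false :: p).
all: by case=> [[]] [_ h _]; [case: (IH2 _ h)|case: (IH1 _ h)] => p Yp;
  [exists (true :: p)|exists (false :: p)].
Qed.

Lemma additive_leaves_atomic A Y p : additive_leaves A Y -> Y p ->
  exists2 F, subtree A p = Some F & atomic F.
Proof.
elim: A Y p => [X|X|A1 IH1 A2 IH2|A1 IH1 A2 IH2|A1 IH1 A2 IH2|A1 IH1 A2 IH2] Y p /=.
1-2: by move=> -> ->; eexists.
1-2: by case=> Y0 h1 h2; case: p => [//|[] p] Yp /=; [apply: IH2 h2 _|apply: IH1 h1 _].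
all: case=> b [Y0 h h0]; case: p => [//|b' p] Yp /=.
all: by have eb := h0 _ _ Yp; subst b'; case: b h Yp {h0} => h Yp;
  [apply: IH2 h _|apply: IH1 h _].
Qed.

Lemma additive_leaves_exclusive A Y w q q' F : additive_leaves A Y ->
  subtree A w = Some F -> is_additive F ->
  Y (w ++ false :: q) -> ~ Y (w ++ true :: q').
Proof.
elim: A Y w => [X|X|A1 IH1 A2 IH2|A1 IH1 A2 IH2|A1 IH1 A2 IH2|A1 IH1 A2 IH2] Y w /=.
1-2: by case: w => [|//] _ [<-].
1-2: by case=> Y0 h1 h2; case: w => [[<-] //|[] w] /=; [exact: IH2 h2|exact: IH1 h1].
all: case=> b [Y0 h h0]; case: w => [|b' w] /= sub add Yf;
  first by move/h0; rewrite -(h0 _ _ Yf).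
all: have eb := h0 _ _ Yf; subst b'; case: b h sub Yf {h0} => h sub Yf;
  [exact: IH2 h sub add Yf|exact: IH1 h sub add Yf].
Qed.

Lemma additive_leaves_complete A Y p F : additive_leaves A Y ->
  subtree A p = Some F -> atomic F ->
  (forall w b q G, p = w ++ b :: q -> subtree A w = Some G -> is_additive G ->
     (exists q', Y (w ++ true :: q')) <-> b) ->
  Y p.
Proof.
elim: A Y p => [X|X|A1 IH1 A2 IH2|A1 IH1 A2 IH2|A1 IH1 A2 IH2|A1 IH1 A2 IH2] Y p /=.
1-2: by case: p => [|//] ->.
1-2: case=> Y0 h1 h2; case: p => [[<-] //|b p] sub atF full.
1-2: by case: b sub full => sub full;
  [apply: (IH2 _ _ h2 sub)|apply: (IH1 _ _ h1 sub)] => // w b q G ep subw addG;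
  by apply: (full (_ :: w) b q G); rewrite //= ep.
all: case=> b0 [Y0 h h0]; case: p => [[<-] //|b p] sub atF full.
all: have eb : b = b0 by
  have [f1 f2] := full [::] b p _ erefl erefl I;
  apply/idP/idP; [by move/f2 => [q /= /h0]|move=> b0T; apply: f1;
    rewrite b0T in h; have [q Yq] := additive_leaves_nonempty h; exists q].
all: subst b0; case: b sub full h {h0} => sub full h;
  [apply: (IH2 _ _ h sub)|apply: (IH1 _ _ h sub)] => // w b q G ep subw addG;
  by apply: (full (_ :: w) b q G); rewrite //= ep.
Qed.

Lemma additive_leaves_exist A : exists Y, additive_leaves A Y.
Proof.
  elim: A => [X|X|A1 [Y1 h1] A2 [Y2 h2]|A1 [Y1 h1] A2 [Y2 h2]|A1 [Y1 h1] A2 _|A1 [Y1 h1] A2 _] /=.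
  1-2: by eexists.
  1-2: by exists [set q | if q is b :: q then if b then Y2 q else Y1 q else False]; split.
  all: exists [set q | if q is false :: q then Y1 q else False], false; split=> //.
  all: by case.
Qed.

Lemma additive_leaves_through A p F : subtree A p = Some F -> atomic F ->
  exists2 Y, additive_leaves A Y & Y p.
Proof.
elim: A p => [X|X|A1 IH1 A2 IH2|A1 IH1 A2 IH2|A1 IH1 A2 IH2|A1 IH1 A2 IH2] p /=.
1-2: by case: p => [|//] _ _; eexists.
1-2: case: p => [[<-] //|[] p] sub atF;
  [have [Y2 h2 Yp] := IH2 _ sub atF; have [Y1 h1] := additive_leaves_exist A1|
  have [Y1 h1 Yp] := IH1 _ sub atF; have [Y2 h2] := additive_leaves_exist A2];
  by exists [set q | if q is b :: q then if b then Y2 q else Y1 q else False] => //; split.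
all: case: p => [[<-] //|b p] sub atF; have [Y1 h1 Yp] :
    exists2 Y1, additive_leaves (if b then A2 else A1) Y1 & Y1 p
 by case: b sub => sub; [exact: IH2 sub atF|exact: IH1 sub atF].
all: exists [set q | if q is b' :: q then b' = b /\ Y1 q else False] => //; exists b; split=> //;
  last by move=> b' q [].
all: by have -> : branch b [set q | if q is b' :: q then b' = b /\ Y1 q else False] = Y1
 by apply/seteqP; split=> q; [case|].
Qed.

Definition flips (Y : set (seq bool)) : set (seq bool) :=
  [set p | Y (map negb p)].

Lemma map_negbK : involutive (map negb).
Proof. by move=> p; rewrite -map_comp map_id_in // => b _ /=; rewrite negbK. Qed.

Lemma additive_leaves_dual A Y : additive_leaves (dual A) Y -> additive_leaves A (flips Y).
Proof.
elim: A Y => [X|X|A1 IH1 A2 IH2|A1 IH1 A2 IH2|A1 IH1 A2 IH2|A1 IH1 A2 IH2] Y /=.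
1-2: by move=> ->; apply/seteqP; split=> -[].
1-2: by case=> Y0 /IH2 h2 /IH1 h1.
all: case=> b [Y0 h h0]; exists (~~ b); split=> //.
1,3: case: b h {h0}; [exact: IH1|exact: IH2].
all: by move=> b' p /h0 <-; rewrite negbK.
Qed.

(** * Additive resolutions of cut sequents *)

(* A cut pair is treated as the formula A ⊗ A^⊥: it has the same addresses,
   and * and ⊗ play the same role in additive resolutions. *)
Definition tree (S : cutseq) (r : nat + nat) : option formula :=
  match r with
  | inl i => omap (fun A => Tens A (dual A)) (onth (cuts S) i)
  | inr j => onth (concl S) j
  end.

Definition subformula (S : cutseq) (v : vertex) : option formula :=
  obind (fun F => subtree F v.2) (tree S v.1).

Lemma label_subformula S v : label S v <> None <-> subformula S v <> None.
Proof.
case: v => [[i|j] p]; rewrite /label /subformula /=; case: onth => [A|] //=.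
  by case: p => [//|b p]; rewrite /=; case: subtree.
by case: subtree.
Qed.

Lemma leafP S v :
  leaf S v <-> exists2 F, subformula S v = Some F & atomic F.
Proof.
have aux (o : option formula) : (exists X, omap kind_of o = Some (KVar X) \/
  omap kind_of o = Some (KNeg X)) <-> exists2 F, o = Some F & atomic F.
  split=> [[X]|[[X|X|? ?|? ?|? ?|? ?] // -> _]]; [|by exists X; left|by exists X; right].
  by case: o => [[Y|Y|? ?|? ?|? ?|? ?]|] /= [] // _; eexists.
rewrite /leaf; case: v => [[i|j] p]; rewrite /subformula /=; case: onth => [A|] /=.
- case: p => [|b p]; last exact: aux.
  by split=> [[X []//]|[F [<-]]].
- by split=> [[X []//]|[F]].
- exact: aux.
- by split=> [[X []//]|[F]].
Qed.

Lemma additiveP S v :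
  additive S v <-> exists2 F, subformula S v = Some F & is_additive F.
Proof.
have aux (o : option formula) : (omap kind_of o = Some KWith \/
  omap kind_of o = Some KPlus) <-> exists2 F, o = Some F & is_additive F.
  split=> [|[[] // C D -> _]]; [|by left|by right].
  by case: o => [[?|?|? ?|? ?|? ?|? ?]|] /= [] // _; eexists.
rewrite /additive /isWith /isPlus; case: v => [[i|j] p]; rewrite /subformula /=;
  case: onth => [A|] /=.
- case: p => [|b p]; last exact: aux.
  by split=> [[]//|[F [<-]]].
- by split=> [[]//|[F]].
- exact: aux.
- by split=> [[]//|[F]].
Qed.

Lemma subtree_nil A : subtree A [::] = Some A.
Proof. by case: A. Qed.

Lemma subtree_cat A p q :
  subtree A (p ++ q) = obind (fun F => subtree F q) (subtree A p).
Proof. by elim: p A => [|b p IH] [] //=. Qed.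

Lemma subformula_cat S r p q :
  subformula S (r, p ++ q) =
  obind (fun F => subtree F q) (subformula S (r, p)).
Proof. by rewrite /subformula /=; case: tree => //= F; rewrite subtree_cat. Qed.

Definition at_root (r : nat + nat) (L : set vertex) : set (seq bool) :=
  [set p | L (r, p)].

(* A cut pair may be deleted as a whole, a conclusion may not. *)
Definition resolved_at (S : cutseq) (L : set vertex) (r : nat + nat) : Prop :=
  if tree S r is Some F
  then additive_leaves F (at_root r L) \/
       (exists i, r = inl i) /\ at_root r L = set0
  else at_root r L = set0.

Definition resolved (S : cutseq) (L : set vertex) : Prop :=
  forall r, resolved_at S L r.

Section Remaining.
Variables (S : cutseq) (D : set nat) (del : vertex -> bool).
Let R := remaining S (additive S) D del.

Lemma remaining_below v u : above v u -> R u -> subformula S v <> None -> R v.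
Proof.
case: v u => [r p] [r' p'] [/= <- /prefixP[q ->]] [l d a] sv; split=> //.
  exact/label_subformula.
move=> w addw [/= er /prefixP[q' ep]]; apply: (a w addw); split=> //=.
by rewrite ep -catA prefix_prefix.
Qed.

Lemma remaining_premise v b : R v -> subformula S (premise v b) <> None ->
  (additive S v -> b = ~~ del v) -> R (premise v b).
Proof.
case: v => [r p] [l d a] sv bv; split=> //.
  exact/label_subformula.
move=> w addw [/= er]; rewrite /premise /= => /prefixP[q].
case/lastP: q => [|q x]; rewrite ?cats0 -?rcons_cat => /rcons_inj[ep ex].
  have ew : w = (r, p) by rewrite ep -er; case: (w).
  by subst w; have := bv addw; rewrite ex; case: (del _).
by apply: (a w addw); split=> //=; rewrite ep prefix_prefix.
Qed.

Lemma remaining_not_deleted v q : additive S v -> ~ R (v.1, v.2 ++ del v :: q).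
Proof.
by move=> addv [_ _ /(_ v addv)]; apply; split=> //=; rewrite -cat_rcons prefix_prefix.
Qed.

(** Induction on the formula at a remaining vertex: both arguments of a multiplicative remain, and
    of an additive exactly the one other than [del]. *)
Lemma remaining_additive_leaves r p F : R (r, p) ->
  subformula S (r, p) = Some F ->
  additive_leaves F [set q | leaves S R (r, p ++ q)].
Proof.
have mult A1 A2 (G : formula) q0 : R (r, q0) -> subformula S (r, q0) = Some G ->
  ~ is_additive G -> ~ atomic G ->
  (forall b q, subtree G (b :: q) = subtree (if b then A2 else A1) q) ->
  ~ leaves S R (r, q0 ++ [::]) /\ forall b, R (r, rcons q0 b) /\
  subformula S (r, rcons q0 b) = Some (if b then A2 else A1).
  move=> Rq sub nadd nat args; split.
    by case=> _ /leafP[G']; rewrite cats0 sub => -[<-].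
  move=> b; have sb : subformula S (r, rcons q0 b) = Some (if b then A2 else A1).
    by rewrite -cats1 subformula_cat sub /= args subtree_nil.
  split=> //; apply: (@remaining_premise (r, q0)) => //; first by rewrite /premise sb.
  by case/additiveP => G'; rewrite sub => -[<-] /nadd.
have add A1 A2 (G : formula) q0 : R (r, q0) -> subformula S (r, q0) = Some G ->
  is_additive G -> ~ atomic G ->
  (forall b q, subtree G (b :: q) = subtree (if b then A2 else A1) q) ->
  exists b, [/\ ~ leaves S R (r, q0 ++ [::]), R (r, rcons q0 b),
  subformula S (r, rcons q0 b) = Some (if b then A2 else A1) &
  forall b' q, leaves S R (r, q0 ++ b' :: q) -> b' = b].
  move=> Rq sub addG nat args; exists (~~ del (r, q0)).
  have addv : additive S (r, q0) by apply/additiveP; exists G.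
  have sb : subformula S (r, rcons q0 (~~ del (r, q0))) =
    Some (if ~~ del (r, q0) then A2 else A1).
    by rewrite -cats1 subformula_cat sub /= args subtree_nil.
  split=> //.
  - by case=> _ /leafP[G']; rewrite cats0 sub => -[<-].
  - by apply: (@remaining_premise (r, q0)) => //; rewrite /premise sb.
  - move=> b' q [Rb' _]; case: (b' =P ~~ del (r, q0)) => // nb.
    by case: (@remaining_not_deleted _ q addv); move: Rb' nb => /=; case: del b' => -[].
have br b q0 : branch b [set q | leaves S R (r, q0 ++ q)] =
  [set q | leaves S R (r, rcons q0 b ++ q)].
  by apply/seteqP; split=> q; rewrite /branch /= cat_rcons.
elim: F p => [X|X|A1 IH1 A2 IH2|A1 IH1 A2 IH2|A1 IH1 A2 IH2|A1 IH1 A2 IH2] p Rp sub.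
1-2: apply/seteqP; split=> q /=;
  [by case=> _ /leafP[G]; rewrite subformula_cat sub /=; case: q
  |by move=> ->; rewrite cats0; split=> //; apply/leafP; eexists; first exact: sub].
1-2: have [] := mult A1 A2 _ _ Rp sub; rewrite //= => n0 h; split=> //;
  rewrite br; [have [] := h false; exact: IH1|have [] := h true; exact: IH2].
all: have [] := add A1 A2 _ _ Rp sub; rewrite //= => b [n0 Rb sb ub]; exists b; split=> //;
  rewrite br; case: b Rb sb {ub}; [exact: IH2|exact: IH1].
Qed.

Lemma remaining_resolved : resolved S (leaves S R).
Proof.
move=> r; rewrite /resolved_at; case T: (tree S r) => [F|]; last first.
  by apply/seteqP; split=> // p [_ /leafP[F]]; rewrite /subformula /= T.
have sub : subformula S (r, [::]) = Some F by rewrite /subformula /= T /= subtree_nil.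
have [Rr|nR] := pselect (R (r, [::])).
  by left; have := remaining_additive_leaves Rr sub.
right; have [[i [er Di]]|nd] := pselect (exists i, r = inl i /\ D i).
  split; first by exists i.
  by apply/seteqP; split=> // p [[_ /(_ i er)]].
case: nR; split; first by apply/label_subformula; rewrite sub.
  by move=> i er Di; apply: nd; exists i.
by move=> w _ [_ /=]; case: (w.2).
Qed.

End Remaining.

Lemma resolved_leaf S L v : resolved S L -> L v -> leaf S v.
Proof.
case: v => r p resL Lv; apply/leafP; move: (resL r); rewrite /resolved_at /subformula /=.
have ne : at_root r L <> set0 by move=> e; have : at_root r L p := Lv; rewrite e.
case: tree => [F|//] [h|[]//]; exact: additive_leaves_atomic h Lv.
Qed.

Lemma resolved_additive_resolution S L : resolved S L ->
  exists2 R, additive_resolution S R & leaves S R = L.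
Proof.
move=> resL; pose used w b := exists2 u, L u & above (premise w b) u.
have usedE r w b : used (r, w) b <-> exists q, at_root r L (w ++ b :: q).
  split=> [[[r' u] Lu [/= e /prefixP[q eq]]]|[q Lq]].
    by exists q; rewrite -cat_rcons -eq /at_root /= e.
  by exists (r, w ++ b :: q) => //; split=> //=; rewrite -cat_rcons prefix_prefix.
(* Delete the cut pairs without leaves and, at each additive vertex, the argument without leaves. If
   neither argument has leaves, the right one goes, an arbitrary choice. *)
exists (remaining S (additive S) [set i | at_root (inl i) L = set0]
  (fun w => ~~ `[< used w true >])); first by eexists; eexists.
apply/seteqP; split=> -[r p].
- case=> -[_ nD ndel] /leafP[F]; rewrite /subformula /=.
  have := resL r; rewrite /resolved_at; case T: (tree S r) => [G|//] /= [h|[[i er] e0]] sub atF; last first.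
    by case: (nD i er); rewrite /= -er.
  apply: (additive_leaves_complete h sub atF) => w b q A ep subw addA.
  have addw : additive S (r, w) by apply/additiveP; exists A => //; rewrite /subformula /= T.
  have := ndel _ addw; rewrite /above /premise /= ep => nd.
  split=> [/usedE u|bT].
    by case: b nd {ep} => // -[]; split=> //; rewrite (asboolT u) -cat_rcons prefix_prefix.
  apply/usedE; apply: contrapT => u; apply: nd.
  by split=> //; rewrite (asboolF u) bT -cat_rcons prefix_prefix.
- move=> Lv; have lv := resolved_leaf resL Lv; split=> //; split.
  + by apply/label_subformula; case/leafP: lv => F ->.
  + by move=> i /= er e; have : at_root (inl i) L p by [rewrite /at_root /= -er]; rewrite e.
  + move=> [r' w] addw [/= er /prefixP[q ep]]; subst r'.
    have [u|/asboolF u] := pselect (used (r, w) true); last first.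
      by apply: (elimF (asboolP _) u); exists (r, p) => //; split=> //=; rewrite ep u prefix_prefix.
    move: ep; rewrite (asboolT u) /= cat_rcons => ep.
    move/usedE: u => [q' Lq'].
    case/additiveP: addw => G; rewrite /subformula /=.
    have := resL r; rewrite /resolved_at; case T: (tree S r) => [F|//] /= [h|[_ e0]] sub addG; last first.
      by have := Lq'; rewrite e0.
    by apply: (@additive_leaves_exclusive _ _ _ q _ _ h sub addG _ Lq'); rewrite -ep.
Qed.

(** This is where the absence of units matters: no remaining subtree is without leaves. *)
Lemma leaf_above_resolution S R v : additive_resolution S R -> R v ->
  exists q, leaves S R (v.1, v.2 ++ q).
Proof.
case: v => r p [D [del eR]] Rv; have [lv _ _] : remaining S (additive S) D del (r, p) by rewrite -eR.
case sub: (subformula S (r, p)) => [F|]; last by case/label_subformula: lv.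
rewrite eR in Rv *; exact: additive_leaves_nonempty (remaining_additive_leaves Rv sub).
Qed.

(** * Relational semantics *)

Definition pairing (lam : linking) : Prop :=
  (forall a, lam a -> exists l m, l <> m /\ a = [set l; m]) /\
  (forall a b v, lam a -> lam b -> a v -> b v -> a = b).

Definition well_formed (S : cutseq) (lam : linking) : Prop :=
  pairing lam /\ resolved S (support lam).

(* Negating an address in A gives the dual address in A^⊥, so [mirror]
   exchanges the dual leaves of a cut pair. *)
Definition mirror (v : vertex) : vertex := (v.1, map negb v.2).

Definition respects (lam : linking) (e : vertex -> nat) : Prop :=
  forall a u v, lam a -> a u -> a v -> e u = e v.

Definition matched (lam : linking) (e : vertex -> nat) : Prop :=
  forall i p, support lam (inl i, p) ->
    support lam (mirror (inl i, p)) /\ e (mirror (inl i, p)) = e (inl i, p).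

Definition has_result (lam : linking) (e : vertex -> nat)
    (Y : set vertex) (t : vertex -> nat) : Prop :=
  forall j p, (support lam (inr j, p) <-> Y (inr j, p)) /\
              (Y (inr j, p) -> e (inr j, p) = t (inr j, p)).

(* The pair (Y, t) is a point of the relational semantics: the tokens t of
   the atoms at the leaves Y of the conclusions. *)
Definition realizes (lam : linking) (Y : set vertex) (t : vertex -> nat) : Prop :=
  exists e, [/\ respects lam e, matched lam e & has_result lam e Y t].

(** * Renaming the leaves of cut pairs *)

Lemma support_relocate f lam : support (relocate f lam) = f @` support lam.
Proof.
apply/seteqP; split=> v.
  by case=> _ [a lama <-] [u au <-]; exists u => //; exists a.
by case=> u [a lama au] <-; exists (f @` a); [exists a|exists u].
Qed.

Lemma pairing_relocate f lam :
  (forall u v, support lam u -> support lam v -> f u = f v -> u = v) ->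
  pairing lam -> pairing (relocate f lam).
Proof.
move=> inj [pl dl]; split.
  move=> _ [a lama <-]; have [l [m [nlm ea]]] := pl a lama.
  exists (f l), (f m); split; last by rewrite ea image_setU !image_set1.
  by move=> efl; apply: nlm; apply: inj efl; exists a => //; rewrite ea; [left|right].
move=> _ _ v [a lama <-] [b lamb <-] [u au <-] [w bw ew].
have uw : w = u by apply: inj ew; [exists b|exists a].
by subst w; rewrite (dl a b u).
Qed.

(** The common form of [drop_cut], [split_cut] and the renumbering in [collect]. The set [L] leaves
    out addresses where injectivity would fail, such as those of the cut pair removed by [drop_cut].
    Commuting with [mirror] keeps matched leaves matched. *)
Definition cut_relocation (L : set vertex) (f : vertex -> vertex) : Prop :=
  [/\ forall j p, f (inr j, p) = (inr j, p),
      forall i p, L (inl i, p) -> exists k q, f (inl i, p) = (inl k, q),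
      forall i p k q, L (inl i, p) -> L (inl k, q) ->
        f (inl i, p) = f (inl k, q) -> (inl i, p) = (inl k, q) :> vertex,
      forall i p, L (inl i, p) -> L (mirror (inl i, p))
    & forall i p, L (inl i, p) -> f (mirror (inl i, p)) = mirror (f (inl i, p))].

Section Relocation.
Variables (L : set vertex) (f : vertex -> vertex).
Hypothesis reloc : cut_relocation L f.

Lemma cut_relocation_inj (u v : vertex) :
  L u -> L v -> f u = f v -> u = v.
Proof.
case: reloc => fr fl inj _ _; case: u v => [[i|j] p] [[k|l] q].
- exact: inj.
- by move=> /fl[k [q' ->]] _; rewrite fr.
- by move=> _ /fl[k' [q' ->]]; rewrite fr.
- by rewrite !fr.
Qed.

Lemma relocate_concl M j p : M `<=` L ->
  (f @` M) (inr j, p) <-> M (inr j, p).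
Proof.
case: reloc => fr fl _ _ _ ML; split; last by exists (inr j, p); rewrite ?fr.
case=> -[[i|k] q] Mu; last by rewrite fr => -[<- <-].
by have [k [q' ->]] := fl _ _ (ML _ Mu).
Qed.

Lemma realizes_relocate lam Y t : support lam `<=` L ->
  realizes (relocate f lam) Y t <-> realizes lam Y t.
Proof.
move=> sL; case: (reloc) => fr fl inj mL fm; split=> -[e [re me ye]].
  exists (e \o f); split.
  - by move=> a u v lama au av /=; apply: (re (f @` a)); [exists a|exists u|exists v].
  - move=> i p sv; have [k [q fv]] := fl _ _ (sL _ sv).
    have : support (relocate f lam) (inl k, q).
      by rewrite support_relocate -fv; exists (inl i, p).
    move=> /me[]; rewrite support_relocate -fv -fm; last exact: sL.
    case=> u su fu em; split=> //.
    by have <- : u = mirror (inl i, p) by apply: cut_relocation_inj => //; [exact: sL|exact/mL/sL].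
  - move=> j p; have [eY et] := ye j p; split; last by rewrite /= fr.
    by rewrite -eY support_relocate relocate_concl.
(* [g] inverts [f] on [L], so that [e \o g] carries the tokens forward; its value outside the image
   of [L] is irrelevant. *)
pose g (w : vertex) := xget w [set v | L v /\ f v = w].
have gK v : L v -> g (f v) = v.
  move=> Lv; have [Lg fg] : [set u | L u /\ f u = f v] (g (f v)) by apply: xgetPex; exists v.
  exact: cut_relocation_inj.
have sa a u : lam a -> a u -> L u by move=> lama au; apply: sL; exists a.
exists (e \o g); split.
- move=> _ _ _ [a lama <-] [u au <-] [v av <-] /=.
  by rewrite !gK; [exact: (re a)|exact: (sa a)|exact: (sa a)].
- move=> i p; rewrite support_relocate => -[[[k|k] q] sv fv]; last by rewrite fr in fv.
  rewrite -fv -fm; last exact: sL.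
  have [sm em] := me _ _ sv; split; first by exists (mirror (inl k, q)).
  by rewrite /= !gK //; [exact: sL|exact: sL].
- move=> j p; have [eY et] := ye j p; split; first by rewrite support_relocate relocate_concl.
  move=> Yv; have sv := (eY.2 Yv).
  by have := gK _ (sL _ sv); rewrite fr /= => ->; exact: et.
Qed.

Lemma well_formed_relocate S S' lam : support lam `<=` L ->
  well_formed S lam -> resolved S' (f @` support lam) ->
  well_formed S' (relocate f lam).
Proof.
move=> sL [pl _] res; split; last by rewrite support_relocate.
by apply: pairing_relocate => // u v /sL Lu /sL Lv; exact: cut_relocation_inj.
Qed.

End Relocation.

(** * Merging the links at an atomic cut *)

Section Merge.
Variables (lam : linking) (i : nat).
Let c : vertex := (inl i, [:: false]).
Let c' : vertex := (inl i, [:: true]).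
Hypothesis pair : pairing lam.
Hypothesis only : forall p, support lam (inl i, p) -> p = [:: false] \/ p = [:: true].
Hypothesis both : support lam c <-> support lam c'.

Lemma pairing_other a u : lam a -> a u -> exists2 v, v <> u & a = [set u; v].
Proof.
move=> lama; have [l [m [nlm ->]]] := pair.1 a lama; case=> -> /=.
  by exists m => // e; apply: nlm.
by exists l => //; rewrite setUC.
Qed.

Lemma pairing_neq u v : lam [set u; v] -> u <> v.
Proof.
move=> /pairing_other/(_ (or_introl erefl))[w nwu e] uv; apply: nwu.
have : [set u; v] w by rewrite e; right.
by rewrite -uv => -[].
Qed.

Lemma pairing_set2 a u v : lam a -> a u -> a v -> u <> v -> a = [set u; v].
Proof.
move=> lama au av nuv; have [w nwu e] := pairing_other lama au.
by move: av; rewrite e => -[vu|->] //; case: nuv.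
Qed.

Lemma on_cut v : support lam v -> v.1 = inl i -> v = c \/ v = c'.
Proof. by case: v => r p sv /= er; subst r; case: (only sv) => ->; [left|right]. Qed.

(** The side conditions of [merge_links] only exclude a link between [c] and [c'] themselves, which
    vanishes with the cut; a leaf [u] outside the cut rules it out. *)
Lemma merged_link u v : lam [set u; c] -> lam [set c'; v] ->
  u.1 <> inl i -> merge_links i lam [set u; v].
Proof.
move=> lu lv nu; right; exists u, v; split=> //.
  by move=> e; apply: nu; rewrite e.
move=> e; subst v; apply: nu.
have -> // : u = c'.
have e : [set u; c] = [set c'; c] by apply: (pair.2 _ _ c) => //; right.
have : [set c'; c] u by rewrite -e; left.
by case=> // uc; case: (pairing_neq lu).
Qed.

Lemma support_merge v : support (merge_links i lam) v <-> support lam v /\ v.1 <> inl i.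
Proof.
split.
  case=> a [[lama nc nc'] av|[l [m [ll lm nl nm ->]]] lmv].
    have sv : support lam v by exists a.
    by split=> // /(on_cut sv)[] e; [apply: nc|apply: nc']; rewrite -/c -/c' -e.
  have sl : support lam l by exists [set l; c] => //; left.
  have sm : support lam m by exists [set c'; m] => //; right.
  have ln : l.1 <> inl i by move/(on_cut sl) => [e|//]; case: (pairing_neq ll).
  have mn : m.1 <> inl i by move/(on_cut sm) => [//|e]; case: (pairing_neq lm).
  by case: lmv => ->.
case=> -[a lama av] nv; have [nvc nvc'] : v <> c /\ v <> c' by split=> e; apply: nv; rewrite e.
have [ac|nac] := pselect (a c).
  have ea : a = [set v; c] by exact: pairing_set2.
  have [b lamb bc'] : support lam c' by apply/both; exists a.
  have [m nm eb] := pairing_other lamb bc'.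
  by exists [set v; m]; [apply: merged_link => //; [rewrite -ea|rewrite -eb]|left].
have [ac'|nac'] := pselect (a c'); last by exists a => //; left.
have ea : a = [set c'; v] by apply: pairing_set2 => // e; apply: nvc'.
have [b lamb bc] : support lam c by apply/both; exists a.
have [l nl eb] := pairing_other lamb bc.
exists [set l; v]; last by right.
apply: merged_link; [by rewrite setUC -eb|by rewrite -ea|].
have sl : support lam l by exists b => //; rewrite eb; right.
case/(on_cut sl) => // e; apply: nac; rewrite (pair.2 _ _ c' lama lamb ac') //.
by rewrite eb; right.
Qed.

Lemma pairing_merge : pairing (merge_links i lam).
Proof.
have nc2 a l m : lam a -> ~ a c -> ~ a c' -> lam [set l; c] -> lam [set c'; m] ->
  forall v, a v -> ~ [set l; m] v.
  move=> lama nc nc' ll lm v av [] /= e; subst v.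
    by apply: nc; rewrite (pair.2 _ _ l lama ll) //; [right|left].
  by apply: nc'; rewrite (pair.2 _ _ m lama lm) //; [left|right].
split.
  move=> a [[lama nc nc']|[l [m [ll lm nl nm ->]]]]; first exact: pair.1.
  exists l, m; split=> // e; subst m.
  have e := pair.2 _ _ l ll lm (or_introl erefl) (or_intror erefl).
  have : [set c'; l] c by rewrite -e; right.
  by case=> // e'; apply: nm.
move=> a b v [[lama nc nc']|[l [m [ll lm nl nm ->]]]] [[lamb nd nd']|[k [n [lk ln nk nn ->]]]].
- exact: pair.2.
- by move=> av bv; case: (nc2 _ _ _ lama nc nc' lk ln v).
- by move=> av bv; case: (nc2 _ _ _ lamb nd nd' ll lm v).
- move=> _ _.
  have e1 := pair.2 _ _ c ll lk (or_intror erefl) (or_intror erefl).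
  have e2 := pair.2 _ _ c' lm ln (or_introl erefl) (or_introl erefl).
  have [e|e] : [set k; c] l by rewrite -e1; left.
  + have [e'|->] : [set c'; n] m by rewrite -e2; right.
    * by case: (pairing_neq lm).
    * by rewrite e.
  + by case: (pairing_neq ll).
Qed.

Lemma realizes_merge Y t : realizes (merge_links i lam) Y t <-> realizes lam Y t.
Proof.
have res e : has_result (merge_links i lam) e Y t <-> has_result lam e Y t.
  by split=> h j p; have [h1 h2] := h j p; split=> //; rewrite -h1;
    (split; [|by move/support_merge => []]) || (split; [by case/support_merge|]) => s;
    apply/support_merge.
split=> -[e [re me ye]]; last first.
  (* The old tokens still work: the ends of a merged link carry those of [c] and [c'], which are
     equal because [e] is matched. *)
  exists e; split; last exact/res.
  - move=> a u v [[lama _ _]|[l [m [ll lm nl nm ->]]]] au av; first exact: re au av.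
    have ec : e l = e m.
      rewrite (re _ l c ll (or_introl erefl) (or_intror erefl)).
      rewrite (re _ m c' lm (or_intror erefl) (or_introl erefl)).
      by have [|_ ->] := me i [:: false]; first by exists [set l; c] => //; right.
    by case: au av => -> [] ->.
  - move=> k p /support_merge[sv nk]; have [sm em] := me _ _ sv.
    by split=> //; apply/support_merge.
(* Conversely, tokens must be found for [c] and [c']. All leaves outside the cut that are linked to
   either have the same token: two with the same partner coincide, and two with different partners
   are joined by a merged link. *)
have eqe a v a0 v0 : lam a -> a c \/ a c' -> a v -> v.1 <> inl i ->
    lam a0 -> a0 c \/ a0 c' -> a0 v0 -> v0.1 <> inl i -> e v = e v0.
  have wl a1 a2 u v1 v2 : lam a1 -> a1 u -> a1 v1 -> lam a2 -> a2 u -> a2 v2 ->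
     u.1 = inl i -> v1.1 <> inl i -> v2.1 <> inl i -> v1 = v2.
    move=> l1 u1 w1 l2 u2 w2 iu i1 i2.
    have e1 : a1 = [set u; v1] by apply: pairing_set2 => // e0; apply: i1; rewrite -e0.
    have e2 : a2 = [set u; v2] by apply: pairing_set2 => // e0; apply: i2; rewrite -e0.
    have : [set u; v2] v1 by rewrite -e2 -(pair.2 _ _ u l1 l2 u1 u2).
    by case=> // e0; case: i1; rewrite e0.
  have mg a1 a2 v1 v2 : lam a1 -> a1 c -> a1 v1 -> lam a2 -> a2 c' -> a2 v2 ->
      v1.1 <> inl i -> v2.1 <> inl i -> e v1 = e v2.
    move=> l1 u1 w1 l2 u2 w2 i1 i2; apply: (re [set v1; v2]); [|by left|by right].
    have e1 : a1 = [set v1; c] by apply: pairing_set2 => // e0; apply: i1; rewrite e0.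
    have e2 : a2 = [set c'; v2] by apply: pairing_set2 => // e0; apply: i2; rewrite -e0.
    by apply: merged_link => //; rewrite -?e1 -?e2.
  move=> la [ac|ac] av iv la0 [ac0|ac0] av0 iv0.
  - by rewrite (wl a a0 c v v0).
  - exact: (mg a a0).
  - by symmetry; apply: (mg a0 a).
  - by rewrite (wl a a0 c' v v0).
(* [x] is this common token. If there is no such leaf, because [c] and [c'] are absent or linked to
   each other, any value will do, here 0. *)
have [x ex] : exists x, forall a v, lam a -> a c \/ a c' -> a v -> v.1 <> inl i -> e v = x.
  have [[a0 [v0 [l0 c0 w0 i0]]]|none] :=
    pselect (exists a v, [/\ lam a, a c \/ a c', a v & v.1 <> inl i]).
    by exists (e v0) => a v l ac av iv; apply: (eqe a v a0 v0).
  by exists 0 => a v l ac av iv; case: none; exists a, v.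
pose e' (v : vertex) := if v.1 == inl i then x else e v.
have e'E v : v.1 <> inl i -> e' v = e v by move=> /eqP/negbTE; rewrite /e' => ->.
have e'i v : v.1 = inl i -> e' v = x by rewrite /e' => ->; rewrite eqxx.
exists e'; split.
- move=> a u v lama au av.
  have [ac|nac] := pselect (a c \/ a c').
    have e'x w : a w -> e' w = x.
      by move=> aw; case: (w.1 =P inl i) => iw; [exact: e'i|rewrite e'E //; exact: (ex a)].
    by rewrite !e'x.
  have aE w : a w -> w.1 <> inl i.
    move=> aw iw; have sw : support lam w by exists a.
    by have [e0|e0] := on_cut sw iw; apply: nac; rewrite -e0; [left|right].
  rewrite !e'E; [|exact: aE|exact: aE].
  by apply: (re a) => //; left; split=> // h; apply: nac; [left|right].
- move=> k p sv; have [ki|nk] := pselect (k = i).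
    subst k; split; last by rewrite !e'i.
    by have [e0|e0] := only sv; subst p; apply/both.
  have nki : (inl k, p).1 <> inl i :> nat + nat by case.
  have [sm em] := me k p ((support_merge (inl k, p)).2 (conj sv nki)).
  by case/support_merge: sm => sm _; split; rewrite ?e'E.
- have r : has_result lam e Y t by exact/res.
  by move=> j p; have [h1 h2] := r j p; split=> // /h2 <-; rewrite e'E.
Qed.

End Merge.

(** * Invariance under cut elimination *)

Lemma resolved_at_transfer S S' L L' r r' :
  resolved S L ->
  tree S' r' = tree S r -> at_root r' L' = at_root r L ->
  ((exists i, r = inl i) -> exists i, r' = inl i) -> resolved_at S' L' r'.
Proof.
move=> /(_ r) h eT eL ei; move: h; rewrite /resolved_at eT eL.
by case: tree => // F [h|[h ?]]; [left|right; split=> //; exact: ei].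
Qed.

Lemma resolved_cut S L i A : resolved S L -> onth (cuts S) i = Some A ->
  additive_leaves (Tens A (dual A)) (at_root (inl i) L) \/ at_root (inl i) L = set0.
Proof.
move=> /(_ (inl i)) h e; move: h; rewrite /resolved_at /= e /=.
by case=> [|[_]]; [left|right].
Qed.

Lemma onth_mid (T : Type) (s1 s2 : seq T) x : onth (s1 ++ x :: s2) (size s1) = Some x.
Proof. by rewrite onth_cat ltnn subnn. Qed.

Definition valid (N : net) : Prop := forall lam, N.2 lam -> well_formed N.1 lam.

Definition denotes (N : net) (Y : set vertex) (t : vertex -> nat) : Prop :=
  exists2 lam, N.2 lam & realizes lam Y t.

(** Invariance holds for valid nets only, so preservation of validity is included to make the
    relation transitive. *)
Definition sound (N N' : net) : Prop :=
  valid N -> valid N' /\ forall Y t, denotes N Y t <-> denotes N' Y t.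

Lemma at_root_relocate_concl L f M j : cut_relocation L f -> M `<=` L ->
  at_root (inr j) (f @` M) = at_root (inr j) M.
Proof.
by move=> reloc ML; apply/seteqP; split=> p; have [] := relocate_concl reloc j p ML.
Qed.

(** * Atomic cuts *)

Section Atomic.
Variables (Sig1 Sig2 Gamma : seq formula) (A : formula).
Hypothesis atA : atomic A.
Let i := size Sig1.
Let S := CutSeq (Sig1 ++ A :: Sig2) Gamma.
Let S' := CutSeq (Sig1 ++ Sig2) Gamma.

(** The cut pair is either deleted or keeps both its leaves; this provides the hypotheses [only] and
    [both] for merging. *)
Lemma atomic_cut_leaves L : resolved S L ->
  (forall p, L (inl i, p) -> p = [:: false] \/ p = [:: true]) /\
  (L (inl i, [:: false]) <-> L (inl i, [:: true])).
Proof.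
move=> res; have [/=[n0]|e] := resolved_cut res (onth_mid _ _ _); last first.
  have e' p : L (inl i, p) -> False by move=> h; have : at_root (inl i) L p := h; rewrite e.
  by split=> [p /e' //|]; split=> /e'.
have -> : additive_leaves A (branch false (at_root (inl i) L)) =
  (branch false (at_root (inl i) L) = set1 [::]) by case: (A) atA.
have -> : additive_leaves (dual A) (branch true (at_root (inl i) L)) =
  (branch true (at_root (inl i) L) = set1 [::]) by case: (A) atA.
move=> ef et.
have eb b q : L (inl i, b :: q) <-> q = [::].
  have -> : L (inl i, b :: q) = branch b (at_root (inl i) L) q by [].
  by case: b; rewrite ?ef ?et.
split=> [[|b q] Lp|]; [by case: n0| |by rewrite !eb].
by move: Lp; rewrite eb => ->; case: b; [right|left].
Qed.

Let Off : set vertex := [set v | v.1 <> inl i].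

Lemma drop_cut_relocation : cut_relocation Off (drop_cut i).
Proof.
split=> //=.
- by move=> k p _; eexists; eexists.
- move=> k p l q nk nl [+ ->].
  have {}nk : k <> i by move=> e; apply: nk; rewrite e.
  have {}nl : l <> i by move=> e; apply: nl; rewrite e.
  by move=> e; congr (inl _, _); move: e; case: (ltnP k i); case: (ltnP l i); lia.
Qed.

Lemma resolved_drop_cut L : resolved S L ->
  resolved S' (drop_cut i @` (L `&` Off)).
Proof.
move=> res [k|j]; last first.
  apply: (resolved_at_transfer (r := inr j) res) => //.
  rewrite (at_root_relocate_concl _ drop_cut_relocation); last by move=> v [].
  by apply/seteqP; split=> p; [case|].
(* The index that the cut pair [k] had before cut pair [i] was removed. *)
pose k' := if k < i then k else k.+1.
apply: (resolved_at_transfer (r := inl k') res) => //; last by eexists.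
  rewrite /= !onth_cat -/i /k'; case: ltnP => [->//|ik].
  by rewrite ltnNge (leqW ik) /= subSn.
apply/seteqP; split=> p.
- case=> -[[l|l] q] [Lv nv] //= [e <-]; rewrite /at_root /=.
  suff <- : l = k' by [].
  have {}nv : l <> i by move=> e'; apply: nv; rewrite /= e'.
  by move: e; rewrite /k'; case: (ltnP k i); case: (ltnP l i); lia.
- move=> Lp; exists (inl k', p) => /=.
    by split=> //= -[]; rewrite /k'; case: ltnP; lia.
  by congr (inl _, _); rewrite /k'; case: (ltnP k i) => [->//|h]; rewrite ltnNge (leqW h).
Qed.

Lemma atomic_step_sound (theta : set linking) :
  sound (S, theta) (S', [set relocate (drop_cut i) (merge_links i lam) | lam in theta]).
Proof.
move=> val.
have merge lam : theta lam -> [/\ pairing (merge_links i lam),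
    support (merge_links i lam) = support lam `&` Off &
    forall Y t, realizes (merge_links i lam) Y t <-> realizes lam Y t].
  move=> /val[pl /atomic_cut_leaves[only both]]; split.
  - exact: pairing_merge.
  - by apply/seteqP; split=> v; rewrite support_merge.
  - by move=> Y t; apply: realizes_merge.
have off lam : theta lam -> support (merge_links i lam) `<=` Off.
  by move=> /merge[_ -> _] v [].
split.
  move=> _ [lam lamt <-]; have [pm sm _] := merge lam lamt; split.
    apply: pairing_relocate pm => u v /(off _ lamt) Ou /(off _ lamt) Ov.
    exact: cut_relocation_inj drop_cut_relocation _ _ Ou Ov.
  by rewrite support_relocate sm; apply: resolved_drop_cut; case: (val lam lamt).
move=> Y t; split=> [[lam lamt r]|[_ [lam lamt <-] r]]; have [_ _ rm] := merge lam lamt.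
  exists (relocate (drop_cut i) (merge_links i lam)); first by exists lam.
  by rewrite (realizes_relocate drop_cut_relocation); [rewrite rm|exact: off].
exists lam => //; rewrite -rm -(realizes_relocate drop_cut_relocation) //; exact: off.
Qed.

End Atomic.

(** Passing from [theta] to [theta'] loses no point, since every linking of [theta] that realizes
    one is kept; renaming then changes nothing at the conclusions. *)
Lemma relocated_sound S S' (theta theta' : set linking) (L : set vertex) f :
  cut_relocation L f ->
  (forall lam, theta lam -> well_formed S lam -> support lam `<=` L) ->
  theta' `<=` theta ->
  (forall lam Y t, well_formed S lam -> theta lam -> realizes lam Y t -> theta' lam) ->
  (forall lam, theta' lam -> well_formed S lam ->
     resolved S' (f @` support lam)) ->
  sound (S, theta) (S', [set relocate f lam | lam in theta']).
Proof.
move=> reloc sL sub keep res val; split.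
  move=> _ [lam lamt <-]; have w := val lam (sub _ lamt).
  by apply: (well_formed_relocate reloc _ w); [exact: sL (sub _ lamt) w|exact: res].
move=> Y t; split=> [[lam lamt r]|[_ [lam lamt <-] r]].
  exists (relocate f lam); first by exists lam => //; exact: keep (val _ lamt) lamt r.
  by rewrite (realizes_relocate reloc) //; exact: sL (val _ lamt).
exists lam; first exact: sub.
rewrite -(realizes_relocate reloc) //; exact: sL (sub _ lamt) (val _ (sub _ lamt)).
Qed.

(** * Splitting a cut pair into two *)

Section Split.
Variables (Sig1 Sig2 Gamma : seq formula) (A A1 A2 : formula).
Let i := size Sig1.
Let S := CutSeq (Sig1 ++ A :: Sig2) Gamma.
Let S' := CutSeq (Sig1 ++ A1 :: A2 :: Sig2) Gamma.
Let Deep : set vertex := [set v | v.1 = inl i -> 1 < size v.2].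

Lemma split_cutE k p : (inl k, p) \in Deep ->
  (k < i /\ split_cut i (inl k, p) = (inl k, p)) \/
  (i < k /\ split_cut i (inl k, p) = (inl k.+1, p)) \/
  (exists s b q, [/\ k = i, p = s :: b :: q &
     split_cut i (inl k, p) = (inl (i + (s (+) b)), s :: q)]).
Proof.
rewrite inE /Deep /split_cut; case: (ltngtP k i) => [ki|ki|ki] /=.
- by left.
- by right; left.
- move=> d; right; right; have : 1 < size p by apply: d; rewrite ki.
  by case: p {d} => [|s [|b q]] // _; exists s, b, q.
Qed.

(** [s (+) b] is unchanged when both bits are negated, so mirror images land in the same new cut
    pair. Together with [s] it determines [b], whence injectivity. *)
Lemma split_cut_relocation : cut_relocation Deep (split_cut i).
Proof.
split=> //.
- move=> k p /mem_set /split_cutE[[_ ->]|[[_ ->]|[s [b [q [_ _ ->]]]]]]; by eexists; eexists.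
- move=> k p l q /mem_set /split_cutE hk /mem_set /split_cutE hl.
  case: hk => [[ki ->]|[[ki ->]|[s [b [p' [-> -> ->]]]]]];
  case: hl => [[li ->]|[[li ->]|[s' [b' [q' [-> -> ->]]]]]] [].
  all: try by [move=> -> ->|move=> <- <-].
  all: try by move=> e; exfalso; move: e ki; case: (addb _ _); lia.
  all: try by move=> e; exfalso; move: e li; case: (addb _ _); lia.
  all: try by move=> e; exfalso; move: e ki li; lia.
  move=> /addnI e es ->; subst s'; have -> // : b = b'.
  by move: e; case: s b b' => -[] [].
- by move=> k p; rewrite /Deep /= size_map.
- move=> k p /mem_set dk; have : (inl k, map negb p) \in Deep.
    by move: dk; rewrite !inE /Deep /= size_map.
  rewrite -[mirror (inl k, p)]/(inl k, map negb p) => /split_cutE;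
    case: (split_cutE dk) => [[ki ->]|[[ki ->]|[s [b [p' [-> -> ->]]]]]].
  + by case=> [[_ ->]|[[]|[s [b [q []]]]]] //; lia.
  + by case=> [[]|[[_ ->]|[s [b [q []]]]]] //; lia.
  + case=> [[]|[[]|[s' [b' [q [_ [<- <- <-] ->]]]]]]; rewrite ?ltnn //=.
    by rewrite addbN addNb negbK.
Qed.

(* Leaves s b q of the i-th cut with s (+) b = d lie above the cut on the
   d-th argument, where they have address s q. *)
Definition split_leaves (d : bool) (Y : set (seq bool)) : set (seq bool) :=
  [set p | if p is s :: q then Y (s :: (s (+) d) :: q) else False].

Lemma resolved_split L : resolved S L -> L `<=` Deep ->
  (forall d, let B := if d then A2 else A1 in
     additive_leaves (Tens B (dual B)) (split_leaves d (at_root (inl i) L)) \/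
     split_leaves d (at_root (inl i) L) = set0) ->
  resolved S' (split_cut i @` L).
Proof.
move=> res deep hd [k|j]; last first.
  apply: (resolved_at_transfer (r := inr j) res) => //.
  exact: at_root_relocate_concl split_cut_relocation deep.
have cutE l p : L (inl l, p) -> (inl l, p) \in Deep by move=> /deep; rewrite inE.
have [ki|ik] := ltnP k i.
  apply: (resolved_at_transfer (r := inl k) res) => //=.
    by rewrite !onth_cat ki.
  apply/seteqP; split=> p.
    case=> -[[l|l] q] // Lv;
      case: (split_cutE (cutE _ _ Lv)) => [[_ ->]|[[il ->]|[s [b [q' [_ _ ->]]]]]] [].
    - by move=> ek ep; rewrite -ek -ep.
    - by lia.
    - by lia.
  by move=> Lp; exists (inl k, p) => //=; rewrite ki.
(* Beyond the two new cut pairs [i] and [i.+1], indices are shifted by one. *)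
have [ik2|ki2] := ltnP i.+1 k.
  apply: (resolved_at_transfer (r := inl k.-1) res) => //=; last by eexists.
    rewrite !onth_cat -/i ltnNge ik /=; have -> : (k.-1 < i) = false by lia.
    have -> : k - i = (k - i.+2).+2 by lia.
    by have -> : k.-1 - i = (k - i.+2).+1 by lia.
  apply/seteqP; split=> p.
    case=> -[[l|l] q] // Lv;
      case: (split_cutE (cutE _ _ Lv)) => [[li ->]|[[il ->]|[s [b [q' [_ _ ->]]]]]] [].
    - by lia.
    - by move=> <- <-.
    - by case: (s (+) b); lia.
  move=> Lp; exists (inl k.-1, p) => //=.
  have -> : (k.-1 < i) = false by lia.
  have -> : (k.-1 == i) = false by lia.
  by rewrite prednK //; lia.
have [d ek] : exists d : bool, k = i + d.
  have [->|->] : k = i \/ k = i.+1 by lia.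
    by exists false; rewrite addn0.
  by exists true; rewrite addn1.
have at_k : at_root (inl k) (split_cut i @` L) = split_leaves d (at_root (inl i) L).
  apply/seteqP; split=> p.
    case=> -[[l|l] q] // Lv;
      case: (split_cutE (cutE _ _ Lv)) => [[li ->]|[[il ->]|[s [b [q' [el eq ->]]]]]] [].
    - by lia.
    - by lia.
    - rewrite ek => /addnI e <-; subst l q; rewrite /split_leaves /=.
      by have -> : s (+) d = b by case: (s) (b) (d) e => -[] [].
  case: p => [//|s q] Lp; exists (inl i, [:: s, s (+) d & q]) => //=.
  by rewrite ltnn eqxx ek addKb.
have := hd d; rewrite /resolved_at at_k /= onth_cat -/i ek.
have -> : (i + d < i) = false by lia.
rewrite addKn; case: (d) => /= -[h|h]; [left|right|left|right] => //; split=> //; by eexists.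
Qed.

End Split.

Lemma sound_trans N1 N2 N3 : sound N1 N2 -> sound N2 N3 -> sound N1 N3.
Proof.
move=> s12 s23 v1; have [v2 d12] := s12 v1; have [v3 d23] := s23 v2.
by split=> // Y t; rewrite d12.
Qed.

(** * Multiplicative and additive cuts *)

Section Connective.
Variables (Sig1 Sig2 Gamma : seq formula) (A A1 A2 : formula).
Let i := size Sig1.
Let S := CutSeq (Sig1 ++ A :: Sig2) Gamma.
Let S' := CutSeq (Sig1 ++ A1 :: A2 :: Sig2) Gamma.

Lemma compound_cut_leaves L : resolved S L -> ~ atomic A ->
  L `<=` [set v | v.1 = inl i -> 1 < size v.2].
Proof.
move=> res nat [r p] Lv /= er; subst r.
have nat' : ~ atomic (dual A) by move: nat; case: (A).
have [/=[n0 hf ht]|e] := resolved_cut res (onth_mid _ _ _); last first.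
  by have : at_root (inl i) L p := Lv; rewrite e.
case: p Lv => [|b [|b' q]] // Lv.
have at0 B : additive_leaves B (branch b (at_root (inl i) L)) -> atomic B.
  by move/additive_leaves_atomic => /(_ [::] Lv)[F]; rewrite subtree_nil => -[->].
by case: b at0 {Lv} => at0; [case: nat'|case: nat]; exact: at0.
Qed.

Lemma split_leaves0 d : split_leaves d set0 = set0.
Proof. by apply/seteqP; split=> -[]. Qed.

Lemma mult_step_sound (theta : set linking) : A = Tens A1 A2 \/ A = Par A1 A2 ->
  sound (S, theta) (S', [set relocate (split_cut i) lam | lam in theta]).
Proof.
move=> eA; have nat : ~ atomic A by case: eA => ->.
apply: (relocated_sound (split_cut_relocation Sig1)) => //.
  by move=> lam _ [_ /compound_cut_leaves]; exact.
move=> lam _ [_ res]; apply: (resolved_split res (compound_cut_leaves res nat)) => d /=.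
have [h|->] := resolved_cut res (onth_mid _ _ _); [left|right; exact: split_leaves0].
have {h}[n0 hf ht] := h.
by case: eA hf ht => -> /=[_ h1 h2] [_ h3 h4]; split; case: d.
Qed.

(** The resolution contains the vertices below its leaves, and each of its vertices has a leaf above
    it; hence consistency can be read off the support. *)
Lemma consistentP lam : well_formed S lam ->
  consistent S i lam <->
  forall b q b' q', support lam (inl i, [:: false, b & q]) ->
    support lam (inl i, [:: true, b' & q']) -> b' = ~~ b.
Proof.
move=> [_ res]; split=> [con b q b' q' sb sb'|con b b'].
  have [R addR eR] := resolved_additive_resolution res.
  have below s b0 q0 : support lam (inl i, [:: s, b0 & q0]) ->
      resolution S lam (inl i, [:: s; b0]).
    rewrite -eR => -[Rv lv]; exists R; split=> //.
    case: (addR) Rv => D [del ->] /(remaining_below _); apply.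
      by split=> //; apply/prefixP; exists q0.
    case/leafP: lv => F; rewrite -[s :: b0 :: q0]/([:: s; b0] ++ q0) subformula_cat.
    by case: subformula.
  exact: con (below _ _ _ sb) (below _ _ _ sb').
have up s b0 : resolution S lam (inl i, [:: s; b0]) ->
    exists q, support lam (inl i, [:: s, b0 & q]).
  by move=> [R [addR <- /(leaf_above_resolution addR)]].
by move=> /up[q sb] /up[q' sb']; exact: con sb sb'.
Qed.

(** The mirror image of a leaf above argument [b] of [A] lies above argument [~~ b] of the dual,
    where only one argument has leaves. *)
Lemma additive_cut_consistent lam e : well_formed S lam -> is_additive A ->
  matched lam e -> consistent S i lam.
Proof.
move=> wf addA me; apply/consistentP => // b q b' q' /me[sm _] sb'.
have [/=[_ _ ht]|e0] := resolved_cut wf.2 (onth_mid _ _ _); last first.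
  by have : at_root (inl i) (support lam) [:: true, b' & q'] := sb'; rewrite e0.
have [b0 u] : exists b0, forall b p, branch true (at_root (inl i) (support lam)) (b :: p) -> b = b0.
  by case: (A) addA ht => //= B1 B2 _ [b0 [_ _ u]]; exists b0.
by rewrite (u b' q') // (u (~~ b) (map negb q)).
Qed.

Lemma add_step_sound (theta : set linking) : A = With A1 A2 \/ A = Plus A1 A2 ->
  sound (S, theta)
    (S', [set relocate (split_cut i) lam | lam in theta `&` consistent S i]).
Proof.
move=> eA; have nat : ~ atomic A by case: eA => ->.
have addA : is_additive A by case: eA => ->.
apply: (relocated_sound (split_cut_relocation Sig1)).
- by move=> lam _ [_ /compound_cut_leaves]; exact.
- by move=> lam [].
- move=> lam Y t wf lamt [e [_ me _]]; split=> //; exact: additive_cut_consistent me.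
move=> lam [_ con] wf; have [_ res] := wf.
apply: (resolved_split res (compound_cut_leaves res nat)) => d /=.
have [h|->] := resolved_cut res (onth_mid _ _ _); [|right; exact: split_leaves0].
have {h}[n0 hf ht] := h; move/(consistentP wf) in con.
have [b [hb ub]] : exists b, additive_leaves (if b then A2 else A1)
      (branch b (branch false (at_root (inl i) (support lam)))) /\
    forall b' p, branch false (at_root (inl i) (support lam)) (b' :: p) -> b' = b.
  by case: eA hf => -> /=[b [_ h u]]; exists b.
have [b' [hb' ub']] : exists b, additive_leaves (if b then dual A1 else dual A2)
      (branch b (branch true (at_root (inl i) (support lam)))) /\
    forall b' p, branch true (at_root (inl i) (support lam)) (b' :: p) -> b' = b.
  by case: eA ht => -> /=[b' [_ h u]]; exists b'.
have eb : b' = ~~ b.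
  have [p hp] := additive_leaves_nonempty hb; have [p' hp'] := additive_leaves_nonempty hb'.
  exact: con hp hp'.
(* By consistency all leaves of the cut go to the new cut pair [i + b]; the other one is left empty,
   which counts as deleted. *)
subst b'; have [db|nd] := eqVneq d b; [left|right].
  by subst d; split=> //; case: b hb hb' {ub ub'}.
apply/seteqP; split=> -[|s q] //=; rewrite /split_leaves /=.
by case: s => [/ub'|/ub]; move: nd; case: d b {hb ub hb' ub'} => -[].
Qed.

End Connective.

(** * Garbage collection of cut pairs *)

Section Mask.
Variable T : Type.
Implicit Types (m : bitseq) (s : seq T).

(** [count id (take k m)] is the new index of a kept cut pair [k]; strict growth on the kept ones
    makes the renumbering injective there. *)
Lemma ltn_count_take m k l : k < l -> nth false m k ->
  count id (take k m) < count id (take l m).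
Proof.
elim: m k l => [|b m IH] [|k] [|l] //=; first by move=> _ ->.
by rewrite ltnS ltn_add2l; exact: IH.
Qed.

Lemma onth_mask m s k : nth false m k ->
  onth (mask m s) (count id (take k m)) = onth s k.
Proof.
elim: m s k => [|b m IH] [|x s] [|k] //=; rewrite ?onth0n //.
  by case: b.
by move=> mk; rewrite -(IH s k mk); case: b.
Qed.

Lemma ltn_countP m k : k < count id m ->
  exists2 l, nth false m l & count id (take l m) = k.
Proof.
elim: m k => [|b m IH] //= k; case: b => /= h; last first.
  by have [l ml <-] := IH k h; exists l.+1.
case: k h => [|k] h; first by exists 0.
by have [l ml <-] := IH k h; exists l.+1.
Qed.

End Mask.

Lemma collect_sound N : sound N (collect N).
Proof.
case: N => S theta.
pose m := mkseq (fun k => `[< used theta k >]) (size (cuts S)).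
have sm : size m = size (cuts S) by rewrite size_mkseq.
pose L : set vertex := [set v | forall k, v.1 = inl k -> nth false m k].
pose f (v : vertex) : vertex :=
  if v is (inl k, p) then (inl (count id (take k m)), p) else v.
have reloc : cut_relocation L f.
  split=> //.
  - by move=> k p _; eexists; eexists.
  - move=> k p l q /(_ k erefl) mk /(_ l erefl) ml [e ->]; congr (inl _, _).
    by case: (ltngtP k l) => // h;
      have := ltn_count_take (m := m) h; rewrite ?mk ?ml => /(_ isT); lia.
have sL lam : theta lam -> well_formed S lam -> support lam `<=` L.
  move=> lamt [_ res] [r p] sv k /= er; subst r.
  have [lt|ge] := ltnP k (size (cuts S)).
    by rewrite nth_mkseq //; apply/asboolP; exists lam, (inl k, p).
  have := res (inl k); rewrite /resolved_at /= onth_default //= => e.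
  by have : at_root (inl k) (support lam) p := sv; rewrite e.
apply: (relocated_sound reloc) => // lam lamt wf [k|j]; last first.
  apply: (resolved_at_transfer (r := inr j) wf.2) => //.
  exact: at_root_relocate_concl reloc (sL _ lamt wf).
have [lt|ge] := ltnP k (count id m).
  have [l ml el] := ltn_countP lt.
  apply: (resolved_at_transfer (r := inl l) wf.2) => //.
  - by rewrite /= -/m -el onth_mask.
  - apply/seteqP; split=> p.
      case=> -[[l'|l'] q] // Lv [] e <-.
      suff <- : l' = l by [].
      have ml' := sL _ lamt wf _ Lv l' erefl.
      by case: (ltngtP l' l) => // h;
      have := ltn_count_take (m := m) h; rewrite ?ml ?ml' => /(_ isT); lia.
    by move=> Lv; exists (inl l, p) => //=; rewrite el.
  - by eexists.
rewrite /resolved_at /= -/m onth_default ?size_mask //=.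
apply/seteqP; split=> // p [[[l|l] q] Lv] // [e _].
have ml := sL _ lamt wf _ Lv l erefl.
have lm : l < size m by rewrite ltnNge; apply/negP => h; move: ml; rewrite nth_default.
by have := ltn_count_take lm ml; rewrite take_size; lia.
Qed.

Lemma step_sound N N' : step N N' -> sound N N'.
Proof.
case=> *.
- exact: atomic_step_sound.
- exact: mult_step_sound.
- by refine (@sound_trans _ _ _ _ (@collect_sound _)); exact: add_step_sound.
Qed.

Lemma reduces_sound N N' : reduces N N' -> sound N N'.
Proof.
elim=> [N1 N2|N1|N1 N2 N3 _ s12 _ s23]; first exact: step_sound.
  by [].
exact: (@sound_trans _ _ _ s12 s23).
Qed.

(** * Identity proof-nets *)

Definition links (x y : seq bool -> vertex) (Y : set (seq bool)) : linking :=
  [set [set x p; y p] | p in Y].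

Lemma relocate_links f x y Y : relocate f (links x y Y) = links (f \o x) (f \o y) Y.
Proof.
rewrite /relocate /links image_comp; congr image; apply/funext => p /=.
by rewrite image_setU !image_set1.
Qed.

Lemma relocateU f lam mu : relocate f (lam `|` mu) = relocate f lam `|` relocate f mu.
Proof. exact: image_setU. Qed.

Definition join (Y1 Y2 : set (seq bool)) : set (seq bool) :=
  [set p | if p is b :: q then if b then Y2 q else Y1 q else False].

Lemma links_join x y Y1 Y2 : links x y (join Y1 Y2) =
  links (x \o cons false) (y \o cons false) Y1 `|`
  links (x \o cons true) (y \o cons true) Y2.
Proof.
apply/seteqP; split=> a.
  by case=> -[|[] p] //= Yp <-; [right|left]; exists p.
by case=> -[p Yp <-]; [exists (false :: p)|exists (true :: p)].
Qed.

Lemma links0 x y : links x y set0 = set0.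
Proof. exact: image_set0. Qed.

Lemma join_branch Y : ~ Y [::] -> Y = join (branch false Y) (branch true Y).
Proof. by move=> n0; apply/seteqP; split=> -[|[] p]. Qed.

(** The flag [c] exchanges the arguments: the expanded axioms for [Par] and [Plus] treat the second
    argument first. *)
Definition joinb (c : bool) (Y1 Y2 : set (seq bool)) : set (seq bool) :=
  if c then join Y2 Y1 else join Y1 Y2.

Definition id_links : set (seq bool) -> linking :=
  links (fun p => (inr 0, map negb p)) (fun p => (inr 1, p)).

Section IdentityLinkings.
Variables (c : bool) (A1 A2 : formula).
Variables l1 l2 : set (seq bool) -> linking.

Lemma translation_id_mult (h f g : linking -> linking) :
  (forall Y1 Y2, h (f (l1 Y1) `|` g (l2 Y2)) = id_links (joinb c Y1 Y2)) ->
  [set h lam | lam in [set f lam `|` g mu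
      | lam in l1 @` additive_leaves A1 & mu in l2 @` additive_leaves A2]] =
  id_links @` additive_leaves (if c then Tens A2 A1 else Tens A1 A2).
Proof.
move=> eY; apply/seteqP; split=> lam.
  case=> _ [_ [Y1 h1 <-] [_ [Y2 h2 <-] <-]] <-; exists (joinb c Y1 Y2) => //.
  by rewrite /joinb; case: c; split.
case=> Y aY <-; have [Y1 [Y2 [h1 h2 ->]]] : exists Y1 Y2,
    [/\ additive_leaves A1 Y1, additive_leaves A2 Y2 & Y = joinb c Y1 Y2].
  rewrite /joinb; case: c aY => -[n0 h1 h2];
    [exists (branch true Y), (branch false Y)|exists (branch false Y), (branch true Y)];
    by rewrite -join_branch.
exists (f (l1 Y1) `|` g (l2 Y2)); last exact: eY.
by exists (l1 Y1); [exists Y1|exists (l2 Y2); [exists Y2|]].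
Qed.

Lemma translation_id_add (h : linking -> linking) :
  (forall Y, h (l1 Y) = id_links (joinb c Y set0)) ->
  (forall Y, h (l2 Y) = id_links (joinb c set0 Y)) ->
  [set h lam | lam in l1 @` additive_leaves A1 `|` l2 @` additive_leaves A2] =
  id_links @` additive_leaves (if c then With A2 A1 else With A1 A2).
Proof.
move=> e1 e2; apply/seteqP; split=> lam.
  case=> _ [[Y aY <-]|[Y aY <-]] <-; rewrite ?e1 ?e2; eexists; try reflexivity.
    by rewrite /joinb; case: c => /=; [exists true|exists false]; split=> // -[].
  by rewrite /joinb; case: c => /=; [exists false|exists true]; split=> // -[].
case=> Y aY <-; have [[Y1 h1 ->]|[Y2 h2 ->]] :
    (exists2 Y1, additive_leaves A1 Y1 & Y = joinb c Y1 set0) \/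
    (exists2 Y2, additive_leaves A2 Y2 & Y = joinb c set0 Y2).
- rewrite /joinb; case: c aY => -[b [n0 h1 u]]; move: h1 u; case: b => h1 u;
    [left|right|right|left]; eexists; try exact: h1; rewrite [LHS]join_branch //;
    congr join; apply/seteqP; by split=> // p /u.
- by rewrite -e1; exists (l1 Y1) => //; left; exists Y1.
- by rewrite -e2; exists (l2 Y2) => //; right; exists Y2.
Qed.

End IdentityLinkings.

Lemma translation_id A : translation (id_proof A) = id_links @` additive_leaves A.
Proof.
have atom X : id_links @` additive_leaves (Var X) =
    [set [set [set (inr 0, [::]); (inr 1, [::])]]].
  apply/seteqP; split=> lam.
    by case=> _ -> <-; rewrite /id_links /links image_set1.
  by move=> ->; exists [set [::]] => //; rewrite /id_links /links image_set1.
elim: A => [X|X|A1 IH1 A2 IH2|A1 IH1 A2 IH2|A1 IH1 A2 IH2|A1 IH1 A2 IH2].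
- exact: (esym (atom X)).
(* [Neg X] and [Var X] have the same sets of leaves, and the exchange only swaps the two ends of the
   link. *)
- rewrite -[RHS]/(id_links @` additive_leaves (Var X)) atom /= /relocate.
  by rewrite !image_set1 image_setU !image_set1 setUC.
- rewrite /= IH1 IH2 !image_comp.
  apply: (@translation_id_mult false A1 A2 _ _) => Y1 Y2 /=.
  by rewrite !(relocate_links, relocateU) [RHS]links_join.
- rewrite /= IH1 IH2 !image_comp.
  apply: (@translation_id_mult true A2 A1 _ _) => Y1 Y2 /=.
  by rewrite !(relocate_links, relocateU) [RHS]links_join setUC.
- rewrite /= IH1 IH2 !image_comp.
  apply: (@translation_id_add false A1 A2 _ _) => Y /=.
    by rewrite !relocate_links [RHS]links_join links0 setU0.
  by rewrite !relocate_links [RHS]links_join links0 set0U.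
(* The proof for [Plus] does not end with an exchange, so [h] is the identity here. *)
- rewrite /= IH1 IH2 !image_comp -[LHS]image_id.
  apply: (@translation_id_add true A2 A1 _ _) => Y /=.
    by rewrite !relocate_links [RHS]links_join links0 set0U.
  by rewrite !relocate_links [RHS]links_join links0 setU0.
Qed.

(** * Composition and isomorphisms *)

Lemma linking_well_formed S lam : is_linking S lam -> well_formed S lam.
Proof.
move=> [lk triv [R [D [del eR]] eL]]; split; last first.
  by rewrite -eL eR; exact: remaining_resolved.
split=> [a /lk[l [m [X [ll lm ->]]]]|a b v lama lamb av bv].
  by exists l, m; split=> // e; move: ll; rewrite e lm.
by apply: triv => //; exists v.
Qed.

(** The graph of a token function restricted to the leaves of a resolution, so that values elsewhere
    do not affect equality. *)
Definition point : Type := set (seq bool * nat).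

Definition dual_point (G : point) : point := [set x | G (map negb x.1, x.2)].

Definition tokens (j : nat) (lam : linking) (e : vertex -> nat) : point :=
  [set x | support lam (inr j, x.1) /\ e (inr j, x.1) = x.2].

Lemma dual_pointK : involutive dual_point.
Proof. by move=> G; apply/seteqP; split=> -[p n]; rewrite /dual_point /= map_negbK. Qed.

(** Each link of the identity joins a leaf to its mirror image in the other conclusion, so the two
    conclusions carry dual points. *)
Lemma id_net_tokens A lam e Y t : (id_net A).2 lam -> respects lam e ->
  has_result lam e Y t ->
  forall p n, (Y (inr 0, p) /\ t (inr 0, p) = n) <->
              (Y (inr 1, map negb p) /\ t (inr 1, map negb p) = n).
Proof.
rewrite /= translation_id => -[Z _ <-] re ye p n.
have s0 q : support (id_links Z) (inr 0, q) <-> Z (map negb q).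
  split=> [[_ [q' Zq <-] [] //= [->]]|Zq]; first by rewrite map_negbK.
  by eexists; [exists (map negb q) => //|left]; rewrite map_negbK.
have s1 q : support (id_links Z) (inr 1, q) <-> Z q.
  split=> [[_ [q' Zq <-] [] //= [->]]|Zq] //.
  by eexists; [exists q => //|right].
have [y0 t0] := ye 0 p; have [y1 t1] := ye 1 (map negb p).
rewrite -y0 -y1 s0 s1.
suff ee : Z (map negb p) -> t (inr 0, p) = t (inr 1, map negb p).
  by split=> -[Zp <-]; rewrite ee.
move=> Zp; rewrite -t0 -?t1; first last.
- by rewrite -y0 s0.
- by rewrite -y1 s1.
apply: (re [set (inr 0, p); (inr 1, map negb p)]); [|by left|by right].
by exists (map negb p) => //; rewrite map_negbK.
Qed.

Lemma id_net_realizes A Z : additive_leaves A Z ->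
  exists2 Y : set vertex, denotes (id_net A) Y (fun=> 0) &
    forall p, (Y (inr 0, p) <-> Z (map negb p)) /\ (Y (inr 1, p) <-> Z p).
Proof.
move=> aZ; exists (support (id_links Z)).
  exists (id_links Z); first by rewrite /= translation_id; exists Z.
  exists (fun=> 0); split=> //.
  by move=> i p [_ [q _ <-]] [].
move=> p; split; split.
- by case=> _ [q' Zq <-] [] //= [->]; rewrite map_negbK.
- by move=> Zp; eexists; [exists (map negb p) => //|left; rewrite map_negbK].
- by case=> _ [q' Zq <-] [] //= [->].
- by move=> Zp; eexists; [exists p => //|right].
Qed.

(** * Composition of nets as composition of relations *)

Section Composition.
Variables (C G D A : formula) (theta psi : set linking).
Hypothesis theta_wf : forall lam, theta lam -> well_formed (cut_free [:: G; C]) lam.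
Hypothesis psi_wf : forall mu, psi mu -> well_formed (cut_free [:: dual C; D]) mu.

Let glue lam mu := relocate (comp_left 1) lam `|` relocate (comp_right 1) mu.

Lemma two_conclusions F1 F2 lam v : well_formed (cut_free [:: F1; F2]) lam ->
  support lam v -> v.1 = inr 0 \/ v.1 = inr 1.
Proof.
case: v => r p [_ /(_ r)] + sv /=; case: r sv => [i|[|[|j]]] sv; [|by left|by right|];
  rewrite /resolved_at /= ?onth0n => e.
  by have : at_root (inl i) (support lam) p := sv; rewrite e.
by have : at_root (inr j.+2) (support lam) p := sv; rewrite e.
Qed.

Lemma support_glue lam mu v : theta lam -> psi mu ->
  support (glue lam mu) v <->
  match v with
  | (inr 0, p) => support lam (inr 0, p)
  | (inr 1, p) => support mu (inr 1, p)
  | (inl 0, false :: p) => support lam (inr 1, p)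
  | (inl 0, true :: p) => support mu (inr 0, p)
  | _ => False
  end.
Proof.
move=> /theta_wf wl /psi_wf wm.
have -> : support (glue lam mu) =
    (comp_left 1 @` support lam) `|` (comp_right 1 @` support mu).
  by rewrite -!support_relocate /support /glue bigcup_setU.
split.
  case=> -[[r p] s <-]; [have := two_conclusions wl s|have := two_conclusions wm s];
    by case=> /= er; move: s; rewrite er.
case: v => -[[|i]|[|[|j]]] // p.
- by case: p => [|[] p] // s; [right|left]; [exists (inr 0, p)|exists (inr 1, p)].
- by move=> s; left; exists (inr 0, p).
- by move=> s; right; exists (inr 1, p).
Qed.

Lemma glue_well_formed lam mu : theta lam -> psi mu ->
  well_formed (CutSeq [:: C] [:: G; D]) (glue lam mu).
Proof.
move=> tl pm; have sg := support_glue _ tl pm.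
have [wl wm] := (theta_wf tl, psi_wf pm); split.
  have [pl dl] : pairing (relocate (comp_left 1) lam).
    apply: pairing_relocate wl.1 => -[r p] [r' p'] su sv.
    have := two_conclusions wl su; have := two_conclusions wl sv.
    by case=> /= -> [] /= -> // [->].
  have [pm' dm] : pairing (relocate (comp_right 1) mu).
    apply: pairing_relocate wm.1 => -[r p] [r' p'] su sv.
    have := two_conclusions wm su; have := two_conclusions wm sv.
    by case=> /= -> [] /= -> // [->].
  have disj v : support (relocate (comp_left 1) lam) v ->
                support (relocate (comp_right 1) mu) v -> False.
    rewrite !support_relocate => -[[r p] su <-] [[r' p'] sv].
    have := two_conclusions wl su; have := two_conclusions wm sv.
    by case=> /= -> [] /= ->.
  split=> [a [/pl|/pm']//|a b v [la|ma] [lb|mb] av bv].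
  - exact: dl bv.
  - by case: (disj v); [exists a|exists b].
  - by case: (disj v); [exists b|exists a].
  - exact: dm bv.
have rootE r r' L L' : (forall p, L (r, p) <-> L' (r', p)) -> at_root r L = at_root r' L'.
  by move=> e; apply/seteqP; split=> p /e.
case=> [[|i]|[|[|j]]]; rewrite /resolved_at /= ?onth0n.
- left; split; first by move/sg.
    have := wl.2 (inr 1); rewrite /resolved_at /= => -[h|[[? //]]].
    have -> // : branch false (at_root (inl 0) (support (glue lam mu))) =
        at_root (inr 1) (support lam).
    by apply/seteqP; split=> p; [move/sg|move=> ?; apply/sg].
  have := wm.2 (inr 0); rewrite /resolved_at /= => -[h|[[? //]]].
  have -> // : branch true (at_root (inl 0) (support (glue lam mu))) = at_root (inr 0) (support mu).
  by apply/seteqP; split=> p; [move/sg|move=> ?; apply/sg].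
- by apply/seteqP; split=> // p /sg.
- have -> : at_root (inr 0) (support (glue lam mu)) = at_root (inr 0) (support lam).
    by apply: rootE => p; exact: sg.
  exact: (wl.2 (inr 0)).
- have -> : at_root (inr 1) (support (glue lam mu)) = at_root (inr 1) (support mu).
    by apply: rootE => p; exact: sg.
  exact: (wm.2 (inr 1)).
- by apply/seteqP; split=> // p /sg.
Qed.

Hypothesis red : reduces (compose C [:: G] [:: D] theta psi) (id_net A).

Lemma compose_denotes Y t :
  denotes (compose C [:: G] [:: D] theta psi) Y t <-> denotes (id_net A) Y t.
Proof.
have [_] : valid (id_net A) /\ forall Y t,
    denotes (compose C [:: G] [:: D] theta psi) Y t <-> denotes (id_net A) Y t.
  by apply: (reduces_sound red) => _ [lam tl [mu pm <-]]; exact: glue_well_formed.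
exact.
Qed.

(** Labellings that agree along the cut glue to a matched labelling of the composition, so their
    outer points form a point of the identity. Thus the outer point of [mu] determines that of
    [lam]. *)
Lemma compose_tokens lam e1 mu e2 : theta lam -> respects lam e1 ->
  psi mu -> respects mu e2 -> tokens 1 lam e1 = dual_point (tokens 0 mu e2) ->
  tokens 0 lam e1 = dual_point (tokens 1 mu e2).
Proof.
move=> tl r1 pm r2 ee; have sg := support_glue _ tl pm.
have [wl wm] := (theta_wf tl, psi_wf pm).
(* [e] is [e1] on the leaves coming from [lam] and [e2] on those coming from [mu]. *)
pose e (v : vertex) := match v with
  | (inr 0, p) | (inl 0, false :: p) => e1 (if v.1 is inr 0 then v else (inr 1, behead v.2))
  | (inl 0, true :: p) => e2 (inr 0, p)
  | _ => e2 v
  end.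
have el v : support lam v -> e (comp_left 1 v) = e1 v.
  by case: v => r p /(two_conclusions wl) /= [] ->.
have er v : support mu v -> e (comp_right 1 v) = e2 v.
  by case: v => r p /(two_conclusions wm) /= [] ->.
have rg : respects (glue lam mu) e.
  move=> _ _ _ [[a la <-]|[a ma <-]] [u au <-] [v av <-].
    by rewrite !el; [exact: r1 au av|exists a|exists a].
  by rewrite !er; [exact: r2 au av|exists a|exists a].
have eeP p n : tokens 1 lam e1 (p, n) <-> tokens 0 mu e2 (map negb p, n) by rewrite ee.
have mg : matched (glue lam mu) e.
  move=> [|i] p /sg // ; case: p => [//|[] p] s.
    have [sl el'] : tokens 1 lam e1 (map negb p, e2 (inr 0, p)).
      by apply/eeP; rewrite map_negbK.
    by split; [apply/sg|].
  have [sm em] : tokens 0 mu e2 (map negb p, e1 (inr 1, p)) by apply/eeP.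
  by split; [apply/sg|].
have dn : denotes (compose C [:: G] [:: D] theta psi) (support (glue lam mu)) e.
  exists (glue lam mu); first by exists lam => //; exists mu.
  by exists e; split.
have [nu idnu [e' [re' _ ye']]] := (compose_denotes _ _).1 dn.
have {}dg := id_net_tokens idnu re' ye'.
by apply/seteqP; split=> -[p n] /=; have := dg p n; rewrite !sg => -[].
Qed.

(** Each resolution of [A] with constant token 0 is a point of the identity, hence of the
    composition; its labelling restricts to both components. The token 0 is the one used for the
    unmodified labelling in [no_internal_link]. *)
Lemma compose_total Z : additive_leaves A Z ->
  exists lam e1 mu e2, [/\ theta lam, respects lam e1, psi mu, respects mu e2 &
    [/\ tokens 1 lam e1 = dual_point (tokens 0 mu e2),
        tokens 0 lam e1 = dual_point [set x | Z x.1 /\ 0 = x.2]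
      & tokens 1 mu e2 = [set x | Z x.1 /\ 0 = x.2]]].
Proof.
move=> /id_net_realizes[Y /compose_denotes[_ [lam tl [mu pm <-]] [e [re me ye]]] YZ].
have sg := support_glue _ tl pm.
exists lam, (e \o comp_left 1), mu, (e \o comp_right 1); split=> //.
- by move=> a u v la au av /=; apply: (re (comp_left 1 @` a));
    [left; exists a|exists u|exists v].
- by move=> a u v ma au av /=; apply: (re (comp_right 1 @` a));
    [right; exists a|exists u|exists v].
split; apply/seteqP; split=> -[p n] [] /= s en.
- have [sm em] := me 0 (false :: p) ((sg (inl 0, false :: p)).2 s).
  by split; [exact: ((sg (inl 0, true :: map negb p)).1 sm)|rewrite -en -em].
- have s' : support (glue lam mu) (inl 0, [:: true & map negb p]) by apply/sg.
  have [sm em] := me 0 _ s'; rewrite /mirror /= map_negbK in sm em.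
  by split; [exact: ((sg (inl 0, false :: p)).1 sm)|rewrite -en -em].
- have [y0 t0] := ye 0 p; have s' : support (glue lam mu) (inr 0, p) by apply/sg.
  by split; [apply/(YZ p).1/y0|rewrite -en /= t0 //; apply/y0].
- have [y0 t0] := ye 0 p; have Yp := (YZ p).1.2 s.
  by split; [exact: ((sg (inr 0, p)).1 (y0.2 Yp))|rewrite /= t0].
- have [y0 t0] := ye 1 p; have s' : support (glue lam mu) (inr 1, p) by apply/sg.
  by split; [apply/(YZ p).2/y0|rewrite -en /= t0 //; apply/y0].
- have [y0 t0] := ye 1 p; have Yp := (YZ p).2.2 s.
  by split; [exact: ((sg (inr 1, p)).1 (y0.2 Yp))|rewrite /= t0].
Qed.

End Composition.

Lemma subtree_dual A p :
  subtree (dual A) p = omap dual (subtree A (map negb p)).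
Proof.
elim: A p => [X|X|A1 IH1 A2 IH2|A1 IH1 A2 IH2|A1 IH1 A2 IH2|A1 IH1 A2 IH2] [|[] p] //=.
Qed.

(** * Mutually inverse nets *)

Section Isomorphism.
Variables (A B : formula) (theta theta' : set linking).
Hypothesis theta_net : proof_net (cut_free [:: dual A; B]) theta.
Hypothesis theta'_net : proof_net (cut_free [:: dual B; A]) theta'.
Hypothesis comp_B : reduces (compose B [:: dual A] [:: A] theta theta') (id_net A).
Hypothesis comp_A : reduces (compose A [:: dual B] [:: B] theta' theta) (id_net B).

Let wf lam : theta lam -> well_formed (cut_free [:: dual A; B]) lam.
Proof. by move=> /theta_net.1; exact: linking_well_formed. Qed.

Let wf' lam : theta' lam -> well_formed (cut_free [:: dual B; A]) lam.
Proof. by move=> /theta'_net.1; exact: linking_well_formed. Qed.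

(* Relabelling a link inside one conclusion would not change the token at the
   other conclusion, contradicting injectivity. *)
Lemma no_internal_link lam a l m j : theta lam -> lam a -> a = [set l; m] ->
  l.1 = inr j -> m.1 = inr j -> False.
Proof.
move=> tl la ea lj mj; have w := wf tl.
(* Two labellings that differ exactly on the link [a]. *)
pose e0 (v : vertex) := 0; pose e1 (v : vertex) : nat := `[< a v >].
have r0 : respects lam e0 by [].
have r1 : respects lam e1.
  move=> b u v lb bu bv; rewrite /e1; congr nat_of_bool; apply: asbool_equiv_eq.
  by split=> h; [rewrite (w.1.2 a b u)|rewrite (w.1.2 a b v)].
have al : a l by rewrite ea; left.
have diff : tokens j lam e0 <> tokens j lam e1.
  move=> e; have : tokens j lam e1 (l.2, 0).
    by rewrite -e; split=> //=; rewrite -lj -surjective_pairing; exists a.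
  by case=> _ /=; rewrite -lj -surjective_pairing /e1 asboolT.
have same k : k <> j -> tokens k lam e0 = tokens k lam e1.
  move=> kj; have z p : e1 (inr k, p) = e0 (inr k, p).
    rewrite /e1 asboolF // ea => -[e|e]; apply: kj; [move: lj|move: mj];
      by rewrite -e => -[].
  by apply/seteqP; split=> -[p n] [s /= en]; split=> //=; rewrite ?z // -z.
have zero k : tokens k lam e0 = [set x | at_root (inr k) (support lam) x.1 /\ 0 = x.2] by [].
case: (two_conclusions w (v := l)); first by exists a.
- rewrite lj => -[j0]; subst j.
  have := w.2 (inr 1); rewrite /resolved_at /= => -[h|[[? //]]].
  (* Some [mu] of [theta'] has at its first conclusion the dual of the point of [lam] at [B]. Glued
     over [B] to [lam] with [e0] or [e1], it forces the same point at the other conclusion. *)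
  have [mu [f1 [nu [f2 [tm rm _ _ [_ e _]]]]]] := compose_total wf' wf comp_A h.
  rewrite -zero in e.
  have e' : tokens 1 lam e0 = dual_point (tokens 0 mu f1) by rewrite e dual_pointK.
  apply: diff; rewrite (compose_tokens wf wf' comp_B tl r0 tm rm e').
  by rewrite (compose_tokens wf wf' comp_B tl r1 tm rm) // -same.
- rewrite lj => -[j1]; subst j.
  have := w.2 (inr 0); rewrite /resolved_at /= => -[/additive_leaves_dual h|[[? //]]].
  (* Symmetrically, some [mu] attains at [A] the dual of the point of [lam] there, and gluing over
     [A] forces the point of [lam] at [B]. *)
  have [nu [f2 [mu [f1 [_ _ tm rm [_ _ e]]]]]] := compose_total wf wf' comp_B h.
  have e' : tokens 1 mu f1 = dual_point (tokens 0 lam e0) by rewrite e.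
  apply: diff; rewrite -[LHS]dual_pointK -(compose_tokens wf' wf comp_A tm rm tl r0 e').
  by rewrite (compose_tokens wf' wf comp_A tm rm tl r1) ?dual_pointK // -same.
Qed.

Lemma isomorphism_bipartite : bipartite A B theta.
Proof.
move=> lam a tl la; have [lk _ _] := theta_net.1 lam tl.
have [l [m [X [ll lm ea]]]] := lk a la.
have nl := no_internal_link tl la ea.
have two v : a v -> v.1 = inr 0 \/ v.1 = inr 1.
  by move=> av; apply: two_conclusions (wf tl) _; exists a.
have lfl : leaf (cut_free [:: dual A; B]) l by exists X; left.
have lfm : leaf (cut_free [:: dual A; B]) m by exists X; right.
have [|l0|l1] := two l; first by rewrite ea; left.
- have [|m0|m1] := two m; first by rewrite ea; right.
    by case: (nl 0).
  by exists l, m.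
- have [|m0|m1] := two m; first by rewrite ea; right.
    by exists m, l; rewrite setUC.
  by case: (nl 1).
Qed.

Lemma isomorphism_full : full (cut_free [:: dual A; B]) theta.
Proof.
suff : forall v, leaf (cut_free [:: dual A; B]) v -> exists2 lam, theta lam & support lam v.
  by move=> h v /h[lam tl [a la av]]; exists lam, a.
move=> [r p] /leafP[F]; rewrite /subformula /=.
case: r => [i|[|[|j]]]; rewrite /= ?onth0n //=.
- rewrite subtree_dual; case sub: subtree => [E|] //= [<-] atE.
  have atE' : atomic E by move: atE; case: (E).
  (* A resolution of [A] through the mirror image of the given leaf; its dual is attained at the
     first conclusion of some [lam]. *)
  have [Z aZ Zp] := additive_leaves_through sub atE'.
  have [lam [e1 [mu [e2 [tl _ _ _ [_ e _]]]]]] := compose_total wf wf' comp_B aZ.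
  exists lam => //; have : tokens 0 lam e1 (p, 0) by rewrite e.
  by case.
- move=> sub atF; have [Z aZ Zp] := additive_leaves_through sub atF.
  have [mu [e2 [lam [e1 [_ _ tl _ [_ _ e]]]]]] := compose_total wf' wf comp_A aZ.
  exists lam => //; have : tokens 1 lam e1 (p, 0) by rewrite e.
  by case.
Qed.

End Isomorphism.

Theorem theorem8p11 (A B : formula) (theta theta' : set linking)
  (theta_net : proof_net (cut_free [:: dual A; B]) theta)
  (theta'_net : proof_net (cut_free [:: dual B; A]) theta')
  (comp_B : reduces (compose B [:: dual A] [:: A] theta theta') (id_net A))
  (comp_A : reduces (compose A [:: dual B] [:: B] theta' theta) (id_net B)) :
  (bipartite A B theta /\ full (cut_free [:: dual A; B]) theta) /\
  (bipartite B A theta' /\ full (cut_free [:: dual B; A]) theta').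
Proof.
by split; split; [exact: isomorphism_bipartite comp_A|exact: isomorphism_full comp_A
  |exact: isomorphism_bipartite comp_B|exact: isomorphism_full comp_B].
Qed.
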